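(* Let $\mathcal{M}$ be a matroid of rank $d$ on $n$ elements. The Plücker fan structure on the local Dressian $\mathrm{Dr}(\mathcal{M})$ coincides with the secondary fan structure on $\mathrm{Dr}(\mathcal{M})$; that is, two points $v,w\in\mathrm{Dr}(\mathcal{M})$ lie in the same relatively open cone of one structure if and only if they lie in the same relatively open cone of the other.
   Context: Let $\mathcal{B}$ be the set of bases of $\mathcal{M}$, $e_S=\sum_{i\in S}e_i$, $P_{\mathcal{M}}=\mathrm{conv}\{e_B:B\in\mathcal{B}\}$, and $Sij=S\cup\{i,j\}$. The local Dressian $\mathrm{Dr}(\mathcal{M})\subseteq\mathbb{R}^{\mathcal{B}}/\mathbb{R}\mathbf{1}$ is the set of $w$ such that, with the convention $w_A=\infty$ for $d$-sets $A\notin\mathcal{B}$, for every $S\in\binom{[n]}{d-2}$ and pairwise distinct $i,j,k,l\notin S$ the minimum of $w_{Sij}+w_{Skl},\ w_{Sik}+w_{Sjl},\ w_{Sil}+w_{Sjk}$ is attained at least twice (or all are $\infty$). Plücker fan structure: $v,w$ are in the same cone iff for every such $(S,i,j,k,l)$ the set of terms attaining the minimum is the same for $v$ and $w$. Secondary fan structure: $v,w$ are in the same cone iff they induce the same regular subdivision of $P_{\mathcal{M}}$ (regular subdivision induced by lifting $e_B$ to height $w_B$ and projecting the lower faces), i.e. $\mathrm{Dr}(\mathcal{M})$ regarded as a subfan of the secondary fan of $P_{\mathcal{M}}$. *)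

(* Defs.v *)
From mathcomp Require Import all_boot all_order all_algebra generic_quotient.
From mathcomp Require Import boolp classical_sets reals constructive_ereal.

Set Implicit Arguments.
Unset Strict Implicit.
Unset Printing Implicit Defensive.

Import Order.TTheory GRing.Theory Num.Theory.
Local Open Scope ring_scope.
Local Open Scope quotient_scope.

Record matroid (n d : nat) := Matroid {
  bases : {set {set 'I_n}};
  bases_neq0 : exists B, B \in bases;
  card_basis : forall B, B \in bases -> #|B| = d;
  basis_exchange : forall B1 B2, B1 \in bases -> B2 \in bases ->
    forall i, i \in B1 :\: B2 ->
    exists2 j, j \in B2 :\: B1 & j |: (B1 :\ i) \in bases }.

Definition basis (n d : nat) (M : matroid n d) := {B : {set 'I_n} | B \in bases M}.

Definition weight (R : realType) (n d : nat) (M : matroid n d) :=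
  {ffun basis M -> R^o}.

Definition ones (R : realType) (n d : nat) (M : matroid n d) : weight R M :=
  [ffun=> 1].

Definition weight_equiv (R : realType) (n d : nat) (M : matroid n d) :
  rel (weight R M) := fun v w => v - w \in <[ones R M]>%VS.

Lemma weight_equiv_refl (R : realType) (n d : nat) (M : matroid n d) :
  reflexive (@weight_equiv R n d M).
Proof. by move=> v; rewrite /weight_equiv subrr mem0v. Qed.

Lemma weight_equiv_sym (R : realType) (n d : nat) (M : matroid n d) :
  symmetric (@weight_equiv R n d M).
Proof. by move=> v w; rewrite /weight_equiv -opprB memvN. Qed.

Lemma weight_equiv_trans (R : realType) (n d : nat) (M : matroid n d) :
  transitive (@weight_equiv R n d M).
Proof.
by move=> w v x vw wx; rewrite /weight_equiv -(subrKA w) memvD.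
Qed.

Canonical weight_equiv_equiv (R : realType) (n d : nat) (M : matroid n d) :=
  EquivRel (@weight_equiv R n d M) (@weight_equiv_refl R n d M)
    (@weight_equiv_sym R n d M) (@weight_equiv_trans R n d M).

(* The quotient of R^bases by the line spanned by the all-ones vector. The
   notions below are defined on weights and extended to the quotient through
   [repr]; the lemmas suffixed [_repr] show that this does not depend on the
   representative. *)
Definition tropical_torus (R : realType) (n d : nat) (M : matroid n d) :=
  {eq_quot (@weight_equiv R n d M)}.

Definition ext_weight (R : realType) (n d : nat) (M : matroid n d)
    (w : weight R M) (A : {set 'I_n}) : \bar R :=
  if insub A is Some B then (w B)%:E else +oo%E.

Definition plucker_index (n d : nat) (S : {set 'I_n}) (i j k l : 'I_n) : bool :=
  [&& (#|S| + 2 == d)%N, uniq [:: i; j; k; l]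
    & all [predC S] [:: i; j; k; l]].

Definition plucker_terms (R : realType) (n d : nat) (M : matroid n d)
    (w : weight R M) (S : {set 'I_n}) (i j k l : 'I_n) : 3.-tuple (\bar R) :=
  let W a b := ext_weight w (S :|: [set a; b]) in
  [tuple (W i j + W k l)%E; (W i k + W j l)%E; (W i l + W j k)%E].

(* If all terms are +oo, all three indices belong to this set. *)
Definition argmin (R : realType) (m : nat) (t : m.-tuple (\bar R)) : {set 'I_m} :=
  [set a | [forall b, (tnth t a <= tnth t b)%E]].

Definition plucker_min (R : realType) (n d : nat) (M : matroid n d)
    (w : weight R M) (S : {set 'I_n}) (i j k l : 'I_n) : {set 'I_3} :=
  argmin (plucker_terms w S i j k l).

Definition is_valuation (R : realType) (n d : nat) (M : matroid n d)
    (w : weight R M) : Prop :=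
  forall S i j k l, plucker_index d S i j k l ->
    (2 <= #|plucker_min w S i j k l|)%N.

Definition same_argmins (R : realType) (n d : nat) (M : matroid n d)
    (v w : weight R M) : Prop :=
  forall S i j k l, plucker_index d S i j k l ->
    plucker_min v S i j k l = plucker_min w S i j k l.

Local Open Scope classical_set_scope.

Definition conv_hull (R : realType) (V : lmodType R) (I : finType) (p : I -> V) :
  set V :=
  [set x | exists l : I -> R,
    [/\ forall i, 0 <= l i, \sum_i l i = 1 & x = \sum_i l i *: p i]].

Definition linear_form (R : realType) (n : nat) (u : 'rV[R]_n) (a : R)
    (q : 'rV[R]_n * R^o) : R :=
  \sum_i u 0 i * q.1 0 i + a * q.2.

Definition face (R : realType) (n : nat) (Q : set ('rV[R]_n * R^o))
    (u : 'rV[R]_n) (a : R) : set ('rV[R]_n * R^o) :=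
  [set q | Q q /\ forall q', Q q' -> linear_form u a q <= linear_form u a q'].

Definition lower_faces (R : realType) (n : nat) (Q : set ('rV[R]_n * R^o)) :
  set (set ('rV[R]_n * R^o)) :=
  [set F | exists u : 'rV[R]_n, exists2 a : R, 0 < a & F = face Q u a].

(* The set of cells (of all dimensions) of the regular subdivision of
   [conv_hull p] induced by the height function [h]. *)
Definition regular_subdivision (R : realType) (n : nat) (I : finType)
    (p : I -> 'rV[R]_n) (h : I -> R^o) : set (set 'rV[R]_n) :=
  [set fst @` F | F in lower_faces (conv_hull (fun i => (p i, h i)))].

Definition indicator (R : realType) (n : nat) (S : {set 'I_n}) : 'rV[R]_n :=
  \sum_(i in S) delta_mx 0 i.

Definition matroid_polytope (R : realType) (n d : nat) (M : matroid n d) :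
  set 'rV[R]_n := conv_hull (fun B : basis M => indicator R (val B)).

Definition matroid_subdivision (R : realType) (n d : nat) (M : matroid n d)
    (w : weight R M) : set (set 'rV[R]_n) :=
  regular_subdivision (fun B : basis M => indicator R (val B)) w.

Lemma fst_lift (R : realType) (n : nat) (I : finType) (p : I -> 'rV[R]_n)
    (h : I -> R^o) :
  fst @` conv_hull (fun i => (p i, h i)) = conv_hull p.
Proof.
apply/seteqP; split=> [_ [_ [l [l0 l1 ->]] <-]|x [l [l0 l1 ->]]].
  by exists l; split=> //; rewrite (raddf_sum (@fst _ _)).
exists (\sum_i l i *: (p i, h i)); first by exists l.
by rewrite (raddf_sum (@fst _ _)).
Qed.

Lemma matroid_subdivision_sub (R : realType) (n d : nat) (M : matroid n d)
    (w : weight R M) (C : set 'rV[R]_n) :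
  matroid_subdivision w C -> C `<=` matroid_polytope M.
Proof.
move=> [_ [u [a _ ->]] <-]; rewrite /matroid_polytope -(fst_lift _ w).
by move=> _ [q [Qq _] <-]; exists q.
Qed.

Definition local_dressian (R : realType) (n d : nat) (M : matroid n d) :
  set (tropical_torus R M) := [set w | is_valuation (repr w)].

Definition same_plucker_cone (R : realType) (n d : nat) (M : matroid n d)
    (v w : tropical_torus R M) : Prop :=
  same_argmins (repr v) (repr w).

Definition same_secondary_cone (R : realType) (n d : nat) (M : matroid n d)
    (v w : tropical_torus R M) : Prop :=
  matroid_subdivision (repr v) = matroid_subdivision (repr w).

Lemma pi_reprP (R : realType) (n d : nat) (M : matroid n d) (w : weight R M) :
  exists c : R, forall B, repr (\pi_(tropical_torus R M) w) B = w B + c.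
Proof.
have : repr (\pi_(tropical_torus R M) w) = w %[mod tropical_torus R M].
  by rewrite reprK.
move/eqmodP => /vlineP[c /ffunP e]; exists c => B.
by have := e B; rewrite !ffunE /GRing.scale/= mulr1 => <-; rewrite addrC subrK.
Qed.

Lemma plucker_min_shift (R : realType) (n d : nat) (M : matroid n d)
    (v w : weight R M) (c : R) S i j k l :
  (forall B, v B = w B + c) -> plucker_min v S i j k l = plucker_min w S i j k l.
Proof.
move=> vw; have vwE A : ext_weight v A = (ext_weight w A + c%:E)%E.
  by rewrite /ext_weight; case: insubP => // B _ _; rewrite vw.
have sumE A B : (ext_weight v A + ext_weight v B =
    (ext_weight w A + ext_weight w B) + (c + c)%:E)%E.
  by rewrite !vwE EFinD addeACA.
apply/setP => a; rewrite !inE; apply: eq_forallb => b.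
by rewrite /plucker_terms !sumE !(tnth_nth +oo%E);
  case: a => [[|[|[|//]]] ?]; case: b => [[|[|[|//]]] ?] /=;
  rewrite leeD2rE.
Qed.

Lemma regular_subdivision_shift (R : realType) (n : nat) (I : finType)
    (p : I -> 'rV[R]_n) (g h : I -> R^o) (c : R) :
  (forall i, g i = h i + c) -> regular_subdivision p g = regular_subdivision p h.
Proof.
have hullE (g' h' : I -> R^o) (c' : R) (q : 'rV[R]_n * R^o) :
    (forall i, g' i = h' i + c') -> conv_hull (fun i => (p i, h' i)) q ->
    conv_hull (fun i => (p i, g' i)) (q.1, q.2 + c' : R^o).
  move=> gh [l [l0 l1 ->]]; exists l; split=> //.
  apply/eqP; rewrite -pair_eqE /=; apply/andP; split; apply/eqP.
    by rewrite !(raddf_sum (@fst _ _)).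
  rewrite !(raddf_sum (@snd _ _)) /= -[c']mul1r -l1 mulr_suml -big_split /=.
  by apply: eq_bigr => i _; rewrite gh /GRing.scale /= mulrDr.
have faceE (g' h' : I -> R^o) (c' : R) u a q :
    (forall i, g' i = h' i + c') -> face (conv_hull (fun i => (p i, h' i))) u a q ->
    face (conv_hull (fun i => (p i, g' i))) u a (q.1, q.2 + c' : R^o).
  move=> gh [Qq qmin]; split; first exact: hullE Qq.
  move=> q' Qq'; have hg i : h' i = g' i - c' by rewrite gh addrK.
  have := qmin _ (hullE _ _ _ _ hg Qq'); rewrite /linear_form /=.
  by rewrite mulrDr mulrDr mulrN !addrA lerBrDr.
have sub (g' h' : I -> R^o) (c' : R) : (forall i, g' i = h' i + c') ->
    regular_subdivision p g' `<=` regular_subdivision p h'.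
  move=> gh _ [_ [u [a a0 ->]] <-].
  exists (face (conv_hull (fun i => (p i, h' i))) u a); first by exists u, a.
  have hg i : h' i = g' i - c' by rewrite gh addrK.
  apply/seteqP; split=> _ [q fq <-].
    by exists (q.1, q.2 + c' : R^o) => //; exact: faceE fq.
  by exists (q.1, q.2 - c' : R^o) => //; exact: faceE fq.
move=> gh; apply/seteqP; split; first exact: sub gh.
by apply: (sub h g (- c)) => i; rewrite gh addrK.
Qed.

Lemma local_dressian_repr (R : realType) (n d : nat) (M : matroid n d)
    (w : weight R M) :
  local_dressian (\pi_(tropical_torus R M) w) <-> is_valuation w.
Proof.
have [c wc] := pi_reprP w; rewrite /local_dressian /is_valuation /=.
by split=> H S i j k l /H; rewrite (plucker_min_shift _ _ _ _ _ wc).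
Qed.

Lemma same_plucker_cone_repr (R : realType) (n d : nat) (M : matroid n d)
    (v w : weight R M) :
  same_plucker_cone (\pi_(tropical_torus R M) v) (\pi_(tropical_torus R M) w)
    <-> same_argmins v w.
Proof.
have [b vb] := pi_reprP v; have [c wc] := pi_reprP w.
rewrite /same_plucker_cone /same_argmins.
by split=> H S i j k l /H;
  rewrite (plucker_min_shift _ _ _ _ _ vb) (plucker_min_shift _ _ _ _ _ wc).
Qed.

Lemma same_secondary_cone_repr (R : realType) (n d : nat) (M : matroid n d)
    (v w : weight R M) :
  same_secondary_cone (\pi_(tropical_torus R M) v) (\pi_(tropical_torus R M) w)
    <-> matroid_subdivision v = matroid_subdivision w.
Proof.
have [b vb] := pi_reprP v; have [c wc] := pi_reprP w.
rewrite /same_secondary_cone /matroid_subdivision.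
by rewrite (regular_subdivision_shift _ vb) (regular_subdivision_shift _ wc).
Qed.

(* Main.v *)
(* Encode a weight by its height function on sets, a cell of its subdivision by
   the set of bases minimizing the height plus a linear form.

   Two bases [Sij], [Skl] lie in a common cell iff their term is minimal in the
   three-term relation, so the cells determine the minimizing terms. Conversely, let
   [v] and [w] have the same minimizing terms. After subtracting a linear form, let
   [D] be the minimizers of [v], a maximal cell, and [X] in [D]. Choose a linear
   form making as many exchanges at [X] as possible neutral for both [v] and [w].
   If the endpoints of an exchange are joined by neutral exchanges, pivoting along
   the path shows that the exchange changes [v] and [w] with the same sign; by
   maximality of [D] there is no other exchange at [X]. So [w] is constant on [D]
   and [X] is a local, hence global, minimum of [w]: every cell of [v] is contained
   in a cell of [w]. By symmetry the maximal cells agree, and all cells are faces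
   of maximal ones. *)

Require Import Defs.
From mathcomp Require Import boolp classical_sets reals constructive_ereal.
From mathcomp Require Import all_boot all_order all_algebra.
From mathcomp Require Import zify lra.

Set Implicit Arguments.
Unset Strict Implicit.
Unset Printing Implicit Defensive.

Import Order.TTheory GRing.Theory Num.Theory.
Local Open Scope ring_scope.

(** * Exchanges in sets and linear forms on sets *)

Definition swap (n : nat) (X : {set 'I_n}) (i j : 'I_n) : {set 'I_n} :=
  j |: (X :\ i).

Definition lin (R : realType) (n : nat) (u : 'I_n -> R) (A : {set 'I_n}) : R :=
  \sum_(i in A) u i.

Section Sets.
Variable n : nat.
Implicit Types (X Y S : {set 'I_n}) (i j k l : 'I_n).

Lemma in_swap X i j k : (k \in swap X i j) = (k == j) || (k != i) && (k \in X).
Proof. by rewrite !inE. Qed.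

Lemma swapK X i j : i \in X -> j \notin X -> swap (swap X i j) j i = X.
Proof.
move=> iX jX; apply/setP => k; rewrite !in_swap.
case: (eqVneq k i) => [->|ki] //=; case: (eqVneq k j) => [->|kj] //=.
by rewrite (negbTE jX).
Qed.

Lemma setD_swap X Y i j : i \in X -> i \notin Y -> j \in Y -> j \notin X ->
  swap X i j :\: Y = (X :\: Y) :\ i.
Proof.
move=> iX iY jY jX; apply/setP => k; rewrite !(in_swap, inE).
by case: (eqVneq k j) => [->|kj] /=; rewrite ?jY ?(negbTE jX) ?andbF // andbCA.
Qed.

Lemma card_setD_swap X Y i j : i \in X -> i \notin Y -> j \in Y -> j \notin X ->
  #|X :\: Y| = #|swap X i j :\: Y|.+1.
Proof.
move=> iX iY jY jX; rewrite (cardsD1 i) setD_swap //.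
by rewrite !inE iX iY.
Qed.

End Sets.

Section Lin.
Variables (R : realType) (n : nat).
Implicit Types (u : 'I_n -> R) (A : {set 'I_n}) (i j : 'I_n).

Lemma lin_swap u A i j : i \in A -> j \notin A ->
  lin u (swap A i j) = lin u A - u i + u j.
Proof.
move=> iA jA; rewrite /lin (big_setD1 i iA) /= big_setU1 /=.
  by rewrite addrC [u i + _]addrC addrK.
by rewrite !inE (negbTE jA) andbF.
Qed.

Lemma linD u u' A : lin (fun i => u i + u' i) A = lin u A + lin u' A.
Proof. exact: big_split. Qed.

Lemma linZ c u A : lin (fun i => c * u i) A = c * lin u A.
Proof. by rewrite /lin mulr_sumr. Qed.

Lemma lin_pair u A i j : i \notin A -> j \notin A -> i != j ->
  lin u (A :|: [set i; j]) = lin u A + (u i + u j).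
Proof.
move=> iA jA ij; rewrite /lin finset.setUC -finset.setUA !big_setU1 //=.
  by rewrite addrA addrC.
by rewrite !inE negb_or ij.
Qed.

End Lin.

(** * Three-term relations for two functions at once *)

Definition both (n : nat) (bs : {set {set 'I_n}}) (P : {set 'I_n} * {set 'I_n}) : bool :=
  (P.1 \in bs) && (P.2 \in bs).

Definition val2 (R : realType) (n : nat) (f : {set 'I_n} -> R)
  (P : {set 'I_n} * {set 'I_n}) : R := f P.1 + f P.2.

(** A pair of sets stands for one term of a three-term relation, infinite unless [both] holds. [P]
    and [Q] attain a finite minimum for [v] and for [w]; the third term attains it for both
    functions or for neither. *)
Definition tie (R : realType) (n : nat) (bs : {set {set 'I_n}})
    (v w : {set 'I_n} -> R) (P Q T : {set 'I_n} * {set 'I_n}) : Prop :=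
  [/\ both bs P, both bs Q, val2 v P = val2 v Q, val2 w P = val2 w Q
    & both bs T -> val2 v P = val2 v T /\ val2 w P = val2 w T \/
                   val2 v P < val2 v T /\ val2 w P < val2 w T].

Definition same_ties (R : realType) (n : nat) (bs : {set {set 'I_n}})
    (v w : {set 'I_n} -> R) (P Q T : {set 'I_n} * {set 'I_n}) : Prop :=
  [\/ [/\ ~~ both bs P, ~~ both bs Q & ~~ both bs T],
      tie bs v w P Q T, tie bs v w P T Q | tie bs v w Q T P].

(* [v] and [w] are valuations of [bs] (extended by [+oo]) with the same
   minimizing terms in all three-term relations; [compatible bs v v] says that
   [v] is a valuation. *)
Definition compatible (R : realType) (n : nat) (bs : {set {set 'I_n}})
    (v w : {set 'I_n} -> R) : Prop :=
  forall (S : {set 'I_n}) i j k l, uniq [:: i; j; k; l] ->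
    all [predC S] [:: i; j; k; l] ->
    same_ties bs v w (S :|: [set i; j], S :|: [set k; l])
      (S :|: [set i; k], S :|: [set j; l]) (S :|: [set i; l], S :|: [set j; k]).

Definition mins (R : realType) (n : nat) (bs : {set {set 'I_n}})
    (f : {set 'I_n} -> R) : {set {set 'I_n}} :=
  [set B in bs | [forall A in bs, f B <= f A]].

Section Compatible.
Variables (R : realType) (n : nat) (bs : {set {set 'I_n}}).
Implicit Types (v w f : {set 'I_n} -> R) (X Y : {set 'I_n}).

Lemma minsP f B :
  reflect (B \in bs /\ forall A, A \in bs -> f B <= f A) (B \in mins bs f).
Proof.
rewrite inE; apply: (iffP andP) => -[Bb].
  by move/forall_inP.
by move=> h; split=> //; apply/forall_inP.
Qed.

Lemma compatible_sym v w : compatible bs v w -> compatible bs w v.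
Proof.
move=> h S i j k l u a.
have tieC P Q T : tie bs v w P Q T -> tie bs w v P Q T.
  by move=> [? ? ? ? t]; split=> // /t[] []; [left | right].
by case: (h S i j k l u a) => [?|/tieC ?|/tieC ?|/tieC ?];
  [apply: Or41 | apply: Or42 | apply: Or43 | apply: Or44].
Qed.

Lemma compatible_refl v w : compatible bs v w -> compatible bs v v.
Proof.
move=> h S i j k l u a.
have tieC P Q T : tie bs v w P Q T -> tie bs v v P Q T.
  by move=> [? ? ? ? t]; split=> // /t[] []; [left | right].
by case: (h S i j k l u a) => [?|/tieC ?|/tieC ?|/tieC ?];
  [apply: Or41 | apply: Or42 | apply: Or43 | apply: Or44].
Qed.

(** Each term covers [S] twice and each of the four elements once, so a linear form shifts all three
    terms by the same constant [c]. The forms added to [v] and to [w] may therefore differ. *)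
Lemma compatible_lin v w (a b : 'I_n -> R) : compatible bs v w ->
  compatible bs (fun A => v A + lin a A) (fun A => w A + lin b A).
Proof.
move=> h S i j k l u al.
move: (u) (al); rewrite /= !inE !negb_or -!andbA andbT.
move=> /and5P[ij ik il jk /andP[jl kl]] /and5P[iS jS kS lS _].
pose c (a : 'I_n -> R) := lin a S + lin a S + (a i + a j + a k + a l).
pose P := (S :|: [set i; j], S :|: [set k; l]).
pose Q := (S :|: [set i; k], S :|: [set j; l]).
pose T := (S :|: [set i; l], S :|: [set j; k]).
have E f (g : 'I_n -> R) : [/\ val2 (fun A => f A + lin g A) P = val2 f P + c g,
    val2 (fun A => f A + lin g A) Q = val2 f Q + c g
  & val2 (fun A => f A + lin g A) T = val2 f T + c g].
  by rewrite /val2 /c /=; split; rewrite !lin_pair //; lra.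
have tieE P' Q' T' : (forall f g, [/\
      val2 (fun A => f A + lin g A) P' = val2 f P' + c g,
      val2 (fun A => f A + lin g A) Q' = val2 f Q' + c g
    & val2 (fun A => f A + lin g A) T' = val2 f T' + c g]) ->
    tie bs v w P' Q' T' ->
    tie bs (fun A => v A + lin a A) (fun A => w A + lin b A) P' Q' T'.
  move=> EE [p q vPQ wPQ t]; have [v1 v2 v3] := EE v a; have [w1 w2 w3] := EE w b.
  split; rewrite ?v1 ?v2 ?v3 ?w1 ?w2 ?w3 ?vPQ ?wPQ // => /t[[e1 e2]|[e1 e2]].
    by left; rewrite -e1 -e2 vPQ wPQ.
  by right; rewrite !ltrD2r -vPQ -wPQ.
case: (h S i j k l u al) => [?|t|t|t]; [exact: Or41|apply: Or42|apply: Or43|apply: Or44];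
  apply: tieE t => f g; have [? ? ?] := E f g; split=> //.
Qed.

Lemma compatible_linr v w (u : 'I_n -> R) : compatible bs v w ->
  compatible bs v (fun A => w A + lin u A).
Proof.
move=> /(compatible_lin (fun=> 0) u); suff -> : (fun A => v A + lin (fun=> 0) A) = v by [].
by apply/funext => A; rewrite /lin big1 ?addr0.
Qed.

(** The relation for [S = X :\ i :\ i'] and the elements [i, i', j', j], read at [X]: the term of
    [X] and its double exchange is compared with the two ways of splitting that exchange into single
    ones. *)
Lemma same_ties_swap v w X i i' j j' : compatible bs v w ->
  i \in X -> i' \in X -> i != i' -> j \notin X -> j' \notin X -> j != j' ->
  same_ties bs v w (X, swap (swap X i j) i' j')
    (swap X i' j', swap X i j) (swap X i' j, swap X i j').
Proof.
move=> h iX i'X ii' jX j'X jj'.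
have ij : i != j by apply: contraNneq jX => <-.
have ij' : i != j' by apply: contraNneq j'X => <-.
have i'j : i' != j by apply: contraNneq jX => <-.
have i'j' : i' != j' by apply: contraNneq j'X => <-.
have := h (X :\ i :\ i') i i' j' j.
have -> : X :\ i :\ i' :|: [set i; i'] = X.
  apply/setP => k; rewrite !inE.
  have [->|_] := eqVneq k i; first by rewrite iX /= ?orbT.
  by have [->|_] /= := eqVneq k i'; rewrite ?i'X ?orbF.
have -> : X :\ i :\ i' :|: [set j'; j] = swap (swap X i j) i' j'.
  apply/setP => k; rewrite !(in_swap, inE).
  have [->|_] /= := eqVneq k j'; first by rewrite orbT.
  have [->|_] /= := eqVneq k j; last by rewrite orbF.
  by rewrite orbT (eq_sym j) i'j.
have E x x' y : x \in X -> x' \in X -> x != x' -> x != y -> y \notin X ->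
    X :\ x :\ x' :|: [set x; y] = swap X x' y.
  move=> xX x'X xx' xy yX; apply/setP => k; rewrite !(in_swap, inE).
  have [->|_] /= := eqVneq k y; first by rewrite !orbT.
  rewrite orbF; have [->|_] /= := eqVneq k x; last by rewrite orbF.
  by rewrite xx' xX andbF.
have C : X :\ i :\ i' = X :\ i' :\ i by apply/setP => k; rewrite !inE andbCA.
rewrite (E i i' j') // (E i i' j) // C (E i' i j) // 1?eq_sym // (E i' i j') // 1?eq_sym //.
apply; rewrite /= !inE ?negb_or ?ii' ?ij ?ij' ?i'j ?i'j' (eq_sym j') ?jj' //.
by rewrite !eqxx /= andbF (negbTE jX) (negbTE j'X) !andbF.
Qed.

End Compatible.

(** * Exchange and local optimality in valuated matroids *)

Section Exchange.
Variables (R : realType) (n d : nat) (M : matroid n d).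
Implicit Types (f g : {set 'I_n} -> R) (X Y : {set 'I_n}).

(** At least one of the other two terms belongs to the pair attaining the minimum, so a finite term
    is never the unique minimum. *)
Lemma same_ties_le (v w : {set 'I_n} -> R) P Q T : same_ties (bases M) v w P Q T ->
  both (bases M) P ->
  both (bases M) Q /\ val2 v Q <= val2 v P \/
  both (bases M) T /\ val2 v T <= val2 v P.
Proof.
case=> [[/negbTE-> _ _] //|[p q e _ _] _|[p q e _ _] _|[p q e _ t] /t[] [e' _]].
- by left; rewrite e.
- by right; rewrite e.
- by left; rewrite -e'.
- by left; split=> //; apply: ltW.
Qed.

Lemma card_basesD X Y : X \in bases M -> Y \in bases M -> #|X :\: Y| = #|Y :\: X|.
Proof.
move=> /card_basis Xd /card_basis Yd; apply/eqP.
by rewrite -(eqn_add2l #|X :&: Y|) cardsID finset.setIC cardsID Xd Yd.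
Qed.

Lemma basis_swap X Y i : X \in bases M -> Y \in bases M ->
  i \in X -> i \notin Y -> exists j, [/\ j \in Y, j \notin X & swap X i j \in bases M].
Proof.
move=> Xb Yb iX iY; case: (basis_exchange Xb Yb (i := i)); first by rewrite inE iX iY.
by move=> j; rewrite inE => /andP[jX jY] h; exists j.
Qed.

(** Used to bring [Y] one step closer to [X] while [u] stays outside. If the first exchange brings
    in [u], a second one brings in some [u2], and then [u] is exchanged out again. *)
Lemma basis_swap_avoiding X Y u : X \in bases M -> Y \in bases M ->
  u \in X -> u \notin Y -> (1 < #|Y :\: X|)%N ->
  exists u' a : 'I_n, [/\ u' \in X :\: Y, u' != u, a \in Y :\: X & swap Y a u' \in bases M].
Proof.
move=> Xb Yb uX uY c2.
have [v vYX] : exists v, v \in Y :\: X by apply/card_gt0P; rewrite (ltn_trans _ c2).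
have [vX vY] : v \notin X /\ v \in Y by move: vYX; rewrite inE => /andP.
have [u1 [u1X u1Y Y1b]] := basis_swap Yb Xb vY vX.
have [e|nu] := eqVneq u1 u; last first.
  by exists u1, v; split=> //; rewrite inE u1X u1Y.
rewrite {u1}e in u1X u1Y Y1b.
have /card_gt0P[v1 ] : (0 < #|swap Y v u :\: X|)%N.
  by rewrite -ltnS -card_setD_swap.
rewrite inE => /andP[v1X v1Y1].
have [u2 [u2X u2Y1 Y2b]] := basis_swap Y1b Xb v1Y1 v1X.
move: u2Y1; rewrite in_swap negb_or negb_and negbK => /andP[u2u u2Y].
have v1u : v1 != u by apply: contraNneq v1X => ->.
move: v1Y1; rewrite in_swap (negbTE v1u) /= => /andP[v1v v1Y].
have u2v : u2 != v by apply: contraNneq vX => <-.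
have {}u2Y : u2 \notin Y by move: u2Y; rewrite (negbTE u2v).
have uY2 : u \in swap (swap Y v u) v1 u2.
  by rewrite !in_swap eqxx /= andbT (eq_sym u v1) v1u orbT.
have [j [jY jY2 Y3b]] := basis_swap Y2b Yb uY2 uY.
(* Only [v] and [v1] have left [Y], so expelling [u] restores one of them; what remains is a single
   exchange of the other for [u2]. *)
have : j \in [set v; v1].
  move: jY2; rewrite !in_swap !inE jY.
  by case: (eqVneq j u2) => //= _; case: (eqVneq j v) => //= _; case: (eqVneq j v1);
    case: (eqVneq j u).
rewrite !inE => /orP[] /eqP ej; rewrite {j}ej in jY jY2 Y3b.
- exists u2, v1; split; rewrite ?inE ?u2X ?u2Y ?v1X ?v1Y //.
  suff <- : swap (swap (swap Y v u) v1 u2) u v = swap Y v1 u2 by [].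
  apply/setP => k; rewrite !in_swap; have [->|kv] /= := eqVneq k v.
    by rewrite vY (eq_sym v v1) v1v orbT.
  have [->|ku] //= := eqVneq k u.
  by rewrite (eq_sym u) (negbTE u2u) (negbTE uY) andbF.
- exists u2, v; split; rewrite ?inE ?u2X ?u2Y ?vX ?vY //.
  suff <- : swap (swap (swap Y v u) v1 u2) u v1 = swap Y v u2 by [].
  apply/setP => k; rewrite !in_swap; have [->|kv] /= := eqVneq k v1.
    by rewrite v1Y v1v orbT.
  have [->|ku] //= := eqVneq k u.
  by rewrite (eq_sym u) (negbTE u2u) (negbTE uY) andbF.
Qed.


(* Murota's argument: a potential on [Y :\: X] makes all exchanges of [u] out of
   [X] neutral and all exchanges of [u] into [Y] strictly increasing; an optimal
   exchange of another element into [Y] brings it closer to [X]. *)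
Lemma valuated_exchange f X Y u : compatible (bases M) f f ->
  X \in bases M -> Y \in bases M -> u \in X -> u \notin Y ->
  exists a, [/\ a \in Y :\: X, swap X u a \in bases M, swap Y a u \in bases M
    & f (swap X u a) + f (swap Y a u) <= f X + f Y].
Proof.
have [m] := ubnP #|Y :\: X|; elim: m f Y => // m IH f Y cm cf Xb Yb uX uY.
(* When the difference is a single element, the exchange of [u] turns [X] into [Y] and [Y] into [X],
   and the sum is unchanged. *)
have [c1|c2] := leqP #|Y :\: X| 1.
  have uXY : u \in X :\: Y by rewrite inE uX uY.
  have [a [aY aX h]] := basis_swap Xb Yb uX uY.
  have aYX : a \in Y :\: X by rewrite inE aX aY.
  have YXa : Y :\: X = [set a].
    by apply/esym/eqP; rewrite eqEcard sub1set aYX cards1.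
  have XYu : X :\: Y = [set u].
    by apply/esym/eqP; rewrite eqEcard sub1set uXY cards1 (card_basesD Xb Yb).
  have eY : swap X u a = Y.
    apply/setP => k; rewrite in_swap.
    have := congr1 (fun A : {set 'I_n} => k \in A) XYu.
    have := congr1 (fun A : {set 'I_n} => k \in A) YXa.
    rewrite /= !inE; have [->|_] := eqVneq k a; first by rewrite aY.
    have [->|_] := eqVneq k u; first by rewrite (negbTE uY).
    by case: (k \in X); case: (k \in Y).
  have eX : swap Y a u = X by rewrite -eY swapK.
  by exists a; rewrite eX eY addrC; split.
apply: contrapT => noex.
(* If [swap X u a] is not a basis there is nothing to neutralize, and the [- 1] makes the exchange
   into [Y] cost exactly 1. Otherwise strictness comes from [noex]. *)
pose p a := if a \in Y :\: X then
    (if swap X u a \in bases M then f X - f (swap X u a)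
     else f (swap Y a u) - f Y - 1) else 0.
pose g A := f A + lin p A.
have cg : compatible (bases M) g g by exact: compatible_lin.
have pu : p u = 0 by rewrite /p inE uX.
have gX a : a \in Y :\: X -> swap X u a \in bases M -> g (swap X u a) = g X.
  move=> aYX h; move: (aYX); rewrite inE => /andP[aX aY].
  rewrite /g lin_swap // pu /p aYX h; lra.
have gY a : a \in Y :\: X -> swap Y a u \in bases M -> g Y < g (swap Y a u).
  move=> aYX h; move: (aYX); rewrite inE => /andP[aX aY].
  rewrite /g lin_swap // pu /p aYX; case: ifP => h'; last by lra.
  have : ~ f (swap X u a) + f (swap Y a u) <= f X + f Y.
    by move=> le; apply: noex; exists a; split.
  by move=> /negP; rewrite -ltNge; lra.
have [u0 [a1 [u0XY u0u a1YX h1]]] := basis_swap_avoiding Xb Yb uX uY c2.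
pose Pb a := (a \in Y :\: X) && (swap Y a u0 \in bases M).
have Pa1 : Pb a1 by rewrite /Pb a1YX.
case: (@arg_minP _ _ _ a1 Pb (fun a => g (swap Y a u0)) Pa1) => v0 /andP[v0YX h0] minv0.
move: (u0XY) (v0YX); rewrite !inE => /andP[u0Y u0X] /andP[v0X v0Y].
have uY' : u \notin swap Y v0 u0 by rewrite in_swap (negbTE uY) andbF orbF eq_sym.
have cm' : (#|swap Y v0 u0 :\: X| < m)%N.
  by rewrite -ltnS -card_setD_swap.
have [a [aYX hX hY le]] := IH g _ cm' cg Xb h0 uX uY'.
move: aYX; rewrite setD_swap // !inE => /and3P[av0 aX aY].
have aYX : a \in Y :\: X by rewrite inE aX.
(* By induction the double exchange at [Y] is no higher than [swap Y v0 u0]. The first alternative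
   then contradicts [gY] at [a], the second the choice of [v0] together with [gY] at [v0]. *)
have := same_ties_swap cg v0Y aY; rewrite eq_sym => /(_ u0 u av0 u0Y uY u0u).
move/same_ties_le; rewrite /both /val2 /= Yb hY => /(_ isT).
rewrite (gX _ aYX hX) in le.
case=> -[/andP[b1 b2] le'].
  by have := gY _ aYX b1; lra.
have Pa : Pb a by rewrite /Pb aYX b1.
have := minv0 _ Pa; have := gY _ v0YX b2; lra.
Qed.

(** Induction on [#|Y :\: X|]: [valuated_exchange] bounds [f Y + f X] below by the values at a basis
    closer to [X] and at a neighbour of [X]. Both are at least [f X], by induction and by
    hypothesis. *)
Lemma local_min_global f X : compatible (bases M) f f -> X \in bases M ->
  (forall i j, i \in X -> j \notin X -> swap X i j \in bases M ->
    f X <= f (swap X i j)) ->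
  X \in mins (bases M) f.
Proof.
move=> cf Xb loc; apply/minsP; split=> // Y.
have [m] := ubnP #|Y :\: X|; elim: m Y => // m IH Y cm Yb.
have [/eqP|/card_gt0P[u]] := posnP #|Y :\: X|.
  rewrite cards_eq0 finset.setD_eq0 => YX; suff -> : Y = X by rewrite lexx.
  by apply/eqP; rewrite eqEcard YX (card_basis Xb) (card_basis Yb) leqnn.
rewrite inE => /andP[uX uY].
have [a [aXY h1 h2 le]] := valuated_exchange cf Yb Xb uY uX.
move: aXY; rewrite inE => /andP[aY aX].
have := loc _ _ aX uX h2.
have : f X <= f (swap Y u a).
  by apply: IH => //; rewrite -ltnS -card_setD_swap.
lra.
Qed.

(** The two bases produced by [valuated_exchange] have sum at most twice the minimum, so both are
    minimizers. Iterating leads from [Y] to [X] within the minimizers. *)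
Lemma mins_connected f X Y : compatible (bases M) f f ->
  X \in mins (bases M) f -> Y \in mins (bases M) f -> Y :\: X != finset.set0 ->
  exists i j, [/\ i \in Y :\: X, j \in X :\: Y & swap Y i j \in mins (bases M) f].
Proof.
move=> cf /minsP[Xb Xm] /minsP[Yb Ym] /set0Pn[u]; rewrite inE => /andP[uX uY].
have [a [aXY h1 h2 le]] := valuated_exchange cf Yb Xb uY uX.
exists u, a; split=> //; first by rewrite inE uX.
apply/minsP; split=> // A Ab; have := Xm _ h2; have := Ym _ Ab; lra.
Qed.

(** Induction on [#|Y :\: X|]. Two steps from [Y] towards [X] inside the minimizers give a
    three-term relation whose first term is minimal for [v], so another term ties with it. That term
    consists of minimizers of [v] closer to [X], where [w] is known, and the tie for [w] determines
    [w Y]. *)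
Lemma const_on_mins (v w : {set 'I_n} -> R) X : compatible (bases M) v w ->
  X \in mins (bases M) v ->
  (forall i j, i \in X -> j \notin X -> swap X i j \in mins (bases M) v ->
    w (swap X i j) = w X) ->
  {in mins (bases M) v, forall Y, w Y = w X}.
Proof.
move=> c Xm loc Y; have cv := compatible_refl c.
have [Xb Xmin] := minsP _ _ _ Xm.
have [m] := ubnP #|Y :\: X|; elim: m Y => // m IH Y cm Ym.
have [Yb Ymin] := minsP _ _ _ Ym.
have [c0|c0] := eqVneq (Y :\: X) finset.set0.
  suff -> : Y = X by []; apply/eqP; rewrite eqEcard (card_basis Xb) (card_basis Yb) leqnn.
  by rewrite -finset.setD_eq0 c0 eqxx.
have [y [x [yYX xXY Y1m]]] := mins_connected cv Xm Ym c0.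
move: (yYX) (xXY); rewrite !inE => /andP[yX yY] /andP[xY xX].
have cY1 : (#|swap Y y x :\: X| < m)%N by rewrite -ltnS -card_setD_swap.
have [c1|c1] := eqVneq (swap Y y x :\: X) finset.set0.
  have [Y1b _] := minsP _ _ _ Y1m.
  have e : swap Y y x = X.
    apply/eqP; rewrite eqEcard (card_basis Xb) (card_basis Y1b) leqnn.
    by rewrite -finset.setD_eq0 c1 eqxx.
  have eY : swap X x y = Y by rewrite -e swapK.
  by rewrite -{1}eY loc // eY.
have [y' [x' [y'YX x'XY Y2m]]] := mins_connected cv Xm Y1m c1.
move: y'YX x'XY; rewrite setD_swap // !inE => /and3P[y'y y'X y'Y].
rewrite negb_or => /andP[/andP[x'x x'Y] x'X].
have x'y : x' != y by apply: contraNneq yX => <-.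
rewrite x'y /= in x'Y.
have [Y2b Y2min] := minsP _ _ _ Y2m; have [Y1b Y1min] := minsP _ _ _ Y1m.
have cY2 : (#|swap (swap Y y x) y' x' :\: X| < m)%N.
  apply: ltn_trans cY1; rewrite [X in (_ < X)%N](@card_setD_swap _ _ _ y' x') //.
    by rewrite in_swap y'y y'Y orbT.
  by rewrite in_swap negb_or x'x x'y.
have near i j : i \in Y -> i \notin X -> j \notin Y -> j \in X ->
    swap Y i j \in bases M -> v (swap Y i j) = v Y -> w (swap Y i j) = w X.
  move=> iY iX jY jX b e; apply: IH; first by rewrite -ltnS -card_setD_swap.
  by apply/minsP; split=> // A Ab; rewrite e Ymin.
have wY2 := IH _ cY2 Y2m.
have vY2 : v (swap (swap Y y x) y' x') = v Y.
  by apply/eqP; rewrite eq_le Ymin // Y2min.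
have := same_ties_swap c yY y'Y; rewrite eq_sym => /(_ x x' y'y xY x'Y).
rewrite eq_sym => /(_ x'x).
have P : both (bases M) (Y, swap (swap Y y x) y' x') by rewrite /both /= Yb.
have main A A' : both (bases M) (A, A') ->
    val2 v (Y, swap (swap Y y x) y' x') = val2 v (A, A') -> v A = v Y /\ v A' = v Y.
  move=> /andP[/= /Ymin Ab /Ymin A'b]; rewrite /val2 /= vY2 => e.
  by split; apply/eqP; rewrite eq_le; apply/andP; split=> //; lra.
have close i j i' j' : i \in Y -> i \notin X -> j \notin Y -> j \in X ->
    i' \in Y -> i' \notin X -> j' \notin Y -> j' \in X ->
    both (bases M) (swap Y i j, swap Y i' j') ->
    val2 v (Y, swap (swap Y y x) y' x') = val2 v (swap Y i j, swap Y i' j') ->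
    val2 w (Y, swap (swap Y y x) y' x') = val2 w (swap Y i j, swap Y i' j') ->
    w Y = w X.
  move=> iY iX jY jX i'Y i'X j'Y j'X q ev.
  have [e1 e2] := main _ _ q ev; case/andP: q => q1 q2.
  rewrite /val2 /= wY2 (near _ _ iY iX jY jX q1 e1) (near _ _ i'Y i'X j'Y j'X q2 e2).
  lra.
case=> [[/negP[]//] _ _|[_ q ev ew _]|[_ q ev ew _]|[q q' ev ew /(_ P)[]]].
- exact: close q ev ew.
- exact: close q ev ew.
- by case=> e1 e2; apply: close q (esym e1) (esym e2).
- case=> + _; rewrite /val2 /= vY2; case/andP: q => /= q1 q2.
  by have := Ymin _ q1; have := Ymin _ q2; lra.
Qed.

End Exchange.

(** * Paths of neutral exchanges at a minimizer *)

Section NeutralPaths.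
Variables (R : realType) (n d : nat) (M : matroid n d).
Implicit Types (v w : {set 'I_n} -> R) (X Y : {set 'I_n}).

Definition neutral_swap v w X i j : bool :=
  [&& i \in X, j \notin X, swap X i j \in bases M, v (swap X i j) == v X
    & w (swap X i j) == w X].

(** An undirected graph, bipartite between [X] and its complement: at most one of the two
    orientations is an exchange at [X]. *)
Definition neutral v w X : rel 'I_n :=
  [rel i j | neutral_swap v w X i j || neutral_swap v w X j i].

(** A negative sign is not listed, since [X] minimizes [v] wherever this is applied. *)
Definition same_sign v w X Y : Prop :=
  v Y = v X /\ w Y = w X \/ v X < v Y /\ w X < w Y.

Lemma neutral_swapP v w X i j : reflect
  [/\ i \in X, j \notin X, swap X i j \in bases M, v (swap X i j) = v X
    & w (swap X i j) = w X] (neutral_swap v w X i j).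
Proof.
apply: (iffP and5P) => -[? ? ? e1 e2]; split=> //; exact/eqP.
Qed.

Lemma neutral_sym v w X : symmetric (neutral v w X).
Proof. by move=> i j; rewrite /neutral /= orbC. Qed.

Lemma neutral_in v w X i j : i \in X -> neutral v w X i j -> neutral_swap v w X i j.
Proof. by move=> iX /orP[//|/neutral_swapP[_]]; rewrite iX. Qed.

(* Induction on the length of the path: a chord shortens it; without chords, the
   rest of the path is still neutral after exchanging along its first edge. *)
Lemma neutral_path_same_sign v w X i j p : compatible (bases M) v w ->
  X \in mins (bases M) v -> i \in X -> j \notin X ->
  path (neutral v w X) i p -> last i p = j -> swap X i j \in bases M ->
  same_sign v w X (swap X i j).
Proof.
move=> c; have [m] := ubnP (size p); elim: m X i j p => // m IH X i j p0.
(* Repetitions are removed so that [i] and [j1] do not recur later: the remaining edges still make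
   sense after exchanging [i] for [j1]. *)
move=> sz0 Xm iX jX /shortenP[p pth up sub] lst Eb.
have sz : (size p < m.+1)%N.
  by apply: leq_ltn_trans sz0; apply: uniq_leq_size => //; case/andP: up.
move=> {p0 sz0 sub}.
have [Xb Xmin] := minsP _ _ _ Xm.
case: p pth lst up sz => [_ /= e|j1 p]; first by rewrite -e iX in jX.
rewrite /= ltnS => /andP[/(neutral_in iX) z1 pth] lst up sz.
have [_ j1X X'b vX' wX'] := neutral_swapP _ _ _ _ _ z1.
case: p pth lst up sz => [_ <- _ _|i2 p]; first by left.
rewrite /= => /andP[z2 pth] lst.
rewrite !inE !negb_or -!andbA => /and5P[ij1 ii2 ip j1i2 /and3P[j1p i2p up]] sz.
have {}z2 : neutral_swap v w X i2 j1.
  by case/orP: z2 => // /neutral_swapP[]; rewrite (negbTE j1X).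
have [i2X _ X2b vX2 wX2] := neutral_swapP _ _ _ _ _ z2.
have n1 : neutral v w X i j1 by rewrite /neutral /= z1.
have n2 : neutral v w X j1 i2 by rewrite /neutral /= z2 orbT.
have jp : j \in p.
  rewrite -lst; case: (p) lst => [/= e|x q _]; first by rewrite -e i2X in jX.
  by rewrite /= mem_last.
have jj1 : j != j1 by apply: contraNneq j1p => <-.
have same0 A : same_sign v w X A -> v A = v X -> w A = w X.
  by case=> -[// + _ e]; rewrite e ltxx.
have Xm' : swap X i j1 \in mins (bases M) v.
  by apply/minsP; split=> // A Ab; rewrite vX' Xmin.
(* A chord from [i] to an inner vertex [y]: induction on the segment up to [y] makes the chord
   neutral, and then it replaces that segment. *)
have chord_head y : y \in p -> y \notin X -> y != j -> swap X i y \in bases M ->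
    v (swap X i y) = v X -> same_sign v w X (swap X i j).
  move=> yp yX yj b e; case/splitPr: yp pth lst sz => p1 p2.
  rewrite cat_path last_cat /= => /and3P[pth1 zy pth2] lst sz.
  have s : same_sign v w X (swap X i y).
    apply: (IH _ _ _ [:: j1, i2 & rcons p1 y]) => //=.
    - have : (0 < size p2)%N by case: p2 lst {pth2 sz} => //= e'; rewrite e' eqxx in yj.
      by move: sz; rewrite size_cat size_rcons /=; clear; lia.
    - by rewrite n1 n2 rcons_path pth1 zy.
    - by rewrite last_rcons.
  apply: (IH _ _ _ (y :: p2)) => //=.
    by move: sz; rewrite size_cat /=; clear; lia.
  rewrite pth2 andbT; apply/orP; left; apply/neutral_swapP; split=> //.
  exact: same0.
(* A chord from [j1] is treated alike, with the segment reversed because the induction starts at an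
   element of [X]. *)
have chord_next x : x \in p -> x \in X -> swap X x j1 \in bases M ->
    v (swap X x j1) = v X -> same_sign v w X (swap X i j).
  move=> xp xX b e; case/splitPr: xp pth lst sz => p1 p2.
  rewrite cat_path last_cat /= => /and3P[pth1 zx pth2] lst sz.
  have s : same_sign v w X (swap X x j1).
    apply: (IH _ _ _ (rev [:: j1, i2 & p1])) => //=.
    - by move: sz; rewrite size_cat size_rev /=; clear; lia.
    - have := rev_path (neutral v w X) j1 (rcons (i2 :: p1) x).
      rewrite last_rcons belast_rcons => ->.
      rewrite (eq_path (e' := neutral v w X)); last by move=> ? ?; rewrite neutral_sym.
      by rewrite /= n2 rcons_path pth1.
    - by rewrite rev_cons last_rcons.
  apply: (IH _ _ _ [:: j1, x & p2]) => //=.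
    by move: sz; rewrite size_cat /=; clear; lia.
  rewrite n1 /= pth2 andbT; apply/orP; right; apply/neutral_swapP; split=> //.
  exact: same0.
have [s|ns] := pselect (same_sign v w X (swap X i j)); first by [].
(* The edge could stop being neutral only if the crossed exchanges [x] for [j1] and [i] for [y] tie
   with the two neutral ones. They would then leave [v] unchanged and give a chord or, for [x = i2]
   and [y = j], the claim itself; [ns] excludes both. *)
have zX' x y : x \in i2 :: p -> y \in i2 :: p -> neutral_swap v w X x y ->
    neutral_swap v w (swap X i j1) x y.
  move=> xp yp zxy; have [xX yX xyb vxy wxy] := neutral_swapP _ _ _ _ _ zxy.
  have xi : x != i.
    by apply: contraTneq xp => ->; rewrite inE negb_or ii2 ip.
  have yj1 : y != j1.
    by apply: contraTneq yp => ->; rewrite inE negb_or j1i2 j1p.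
  have {}yp : y \in p.
    by move: yp; rewrite inE => /orP[/eqP e|//]; rewrite e i2X in yX.
  have st := same_ties_swap c iX xX.
  have {st} := st j1 y; rewrite eq_sym xi => /(_ isT j1X yX).
  rewrite eq_sym yj1 => /(_ isT) st.
  have Q : both (bases M) (swap X x y, swap X i j1) by rewrite /both /= xyb.
  have noT : ~ (both (bases M) (swap X x j1, swap X i y) /\
      val2 v (swap X x y, swap X i j1) = val2 v (swap X x j1, swap X i y) /\
      val2 w (swap X x y, swap X i j1) = val2 w (swap X x j1, swap X i y)).
    rewrite /both /val2 /= vxy vX' wxy wX' => -[/andP[b1 b2] [ev ew]].
    have e1 : v (swap X x j1) = v X.
      by move: (Xmin _ b1) (Xmin _ b2) ev; clear; lra.
    have e2 : v (swap X i y) = v X by move: ev; lra.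
    have [yj|yj] := eqVneq y j; last exact: ns (chord_head _ yp yX yj b2 e2).
    move: xp; rewrite inE => /orP[/eqP xi2|xp]; last exact: ns (chord_next _ xp xX b1 e1).
    apply: ns; left; rewrite -yj e2; split=> //.
    by move: ew; rewrite xi2 wX2; lra.
  have fin : both (bases M) (X, swap (swap X i j1) x y) ->
      val2 v (X, swap (swap X i j1) x y) = val2 v (swap X x y, swap X i j1) ->
      val2 w (X, swap (swap X i j1) x y) = val2 w (swap X x y, swap X i j1) ->
      neutral_swap v w (swap X i j1) x y.
    rewrite /both /val2 /= vxy vX' wxy wX' => /andP[_ b] e1 e2.
    apply/neutral_swapP; rewrite vX' wX'; split=> //; try lra.
      by rewrite in_swap xi xX orbT.
    by rewrite in_swap negb_or yj1 negb_and yX orbT.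
  case: st => [[_ /negP[]//]|[b _ e1 e2 _]|[b b' e1 e2 /(_ Q)[[e3 e4]|[lt1 lt2]]]
      |[_ b' e1 e2 h]].
  - exact: fin.
  - by apply: fin.
  - move: lt1; rewrite /val2 /= vxy vX'; case/andP: b => _ /= b; have := Xmin _ b.
    by case/andP: b' => /= b1 b2; have := Xmin _ b1; have := Xmin _ b2; move: e1;
      rewrite /val2 /=; lra.
  - by case: noT.
have pth' : path (neutral v w (swap X i j1)) i2 p.
  apply: (@sub_in_path _ [in i2 :: p] (neutral v w X)) pth; last exact/allP.
  move=> x y xp yp /orP[z|z]; apply/orP; [left | right]; exact: zX'.
have szp : (size p < m)%N by exact: ltnW sz.
have sX : swap X i2 j \in bases M -> same_sign v w X (swap X i2 j).
  by move=> b; apply: (IH _ _ _ p).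
have sX' : swap (swap X i j1) i2 j \in bases M ->
    same_sign v w X (swap (swap X i j1) i2 j).
  move=> b; have := IH (swap X i j1) i2 j p szp Xm'.
  rewrite in_swap (eq_sym i2 i) ii2 i2X orbT /= in_swap negb_or jj1 negb_and jX orbT.
  by move/(_ isT isT pth' lst b); rewrite /same_sign vX' wX'.
(* Exchanging [i] or [i2] for [j1] is free, so the three terms measure the change caused by [i2] for
   [j] after the first exchange, by [i2] for [j] at [X], and by [i] for [j] at [X]. Induction gives
   the signs of the first two, and the ties pass them to the third. *)
have := same_ties_swap c iX i2X ii2 j1X jX; rewrite eq_sym => /(_ jj1).
have T : both (bases M) (swap X i2 j1, swap X i j) by rewrite /both /= X2b.
rewrite /same_sign in sX sX' *.
case=> [[_ _ /negP[]//]|[b b' e1 e2 /(_ T) h]|[b b' e1 e2 h]|[b b' e1 e2 h]];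
  move: e1 e2 {h}(h); rewrite /val2 /= vX2 wX2 vX' wX'; case/andP: b => /= b1 b2;
  case/andP: b' => /= b3 b4.
- move: (sX' b2) (sX b3); clear=> s1 s2 e1 e2 h.
  by case: s1 => -[]; case: s2 => -[]; case: h => -[] *; try (left; lra); right; lra.
- move: (sX' b2); clear=> s1 e1 e2 _; case: s1 => -[] *; [left | right]; lra.
- move: (sX b1); clear=> s1 e1 e2 _; case: s1 => -[] *; [left | right]; lra.
Qed.

End NeutralPaths.

(** * Cells as sets of minimizers *)

Definition cell (R : realType) (n : nat) (bs : {set {set 'I_n}})
    (f : {set 'I_n} -> R) (C : {set {set 'I_n}}) : Prop :=
  exists u : 'I_n -> R, C = mins bs (fun A => f A + lin u A).

Section Cells.
Variables (R : realType) (n : nat) (bs : {set {set 'I_n}}).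
Implicit Types (f g q : {set 'I_n} -> R) (X Y : {set 'I_n}).

Lemma eq_mins f g : {in bs, f =1 g} -> mins bs f = mins bs g.
Proof.
move=> e; apply/setP => B; apply/minsP/minsP => -[Bb h]; split=> // A Ab.
  by rewrite -!e // h.
by rewrite !e // h.
Qed.

Lemma cell_lin f u C : cell bs (fun A => f A + lin u A) C <-> cell bs f C.
Proof.
split=> -[u' ->].
  exists (fun i => u i + u' i); apply: eq_mins => A _; rewrite linD; lra.
exists (fun i => u' i + -1 * u i); apply: eq_mins => A _; rewrite linD linZ; lra.
Qed.

Lemma mins_eq f X Y : X \in mins bs f -> Y \in mins bs f -> f X = f Y.
Proof.
by move=> /minsP[Xb Xm] /minsP[Yb Ym]; apply/eqP; rewrite eq_le Xm ?Ym.
Qed.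

(** Tilting [f] along [p] keeps the old minimizers, on which [p] is constant, level with each other.
    The multiplier is the smallest ratio [r] at which a basis with smaller [p] becomes as low as
    [X]. *)
Lemma mins_grow f X E (p : 'I_n -> R) : X \in mins bs f ->
  {in mins bs f, forall Y, lin p Y = lin p X} -> E \in bs -> lin p E < lin p X ->
  exists s, mins bs f \proper mins bs (fun A => f A + lin (fun i => s * p i) A).
Proof.
move=> Xm pc Eb pE; have [Xb Xmin] := minsP _ _ _ Xm.
pose P Y := (Y \in bs) && (lin p Y < lin p X).
pose r Y := (f Y - f X) / (lin p X - lin p Y).
have PE : P E by rewrite /P Eb.
case: (@arg_minP _ _ _ E P r PE) => Z /andP[Zb pZ] Zmin.
have rZ : r Z * (lin p X - lin p Z) = f Z - f X.
  by rewrite /r divfK // subr_eq0 gt_eqF.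
have r0 : 0 <= r Z by rewrite /r divr_ge0 // subr_ge0 ?Xmin // ltW.
exists (r Z); set g := fun A : {set 'I_n} => _.
have gE A : g A = f A + r Z * lin p A by rewrite /g linZ.
have Xg : forall A, A \in bs -> g X <= g A.
  move=> A Ab; rewrite !gE; have [pA|pA] := ltP (lin p A) (lin p X).
    have : r Z <= r A by apply: Zmin; rewrite /P Ab.
    by rewrite /r ler_pdivlMr ?subr_gt0 // -/(r Z); lra.
  by have := ler_wpM2l r0 pA; have := Xmin _ Ab; lra.
apply/properP; split.
  apply/subsetP => Y Ym; have [Yb _] := minsP _ _ _ Ym.
  apply/minsP; split=> // A Ab; rewrite {1}gE pc // (mins_eq Ym Xm) -gE; exact: Xg.
exists Z; last by apply/negP => /pc e; rewrite e ltxx in pZ.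
apply/minsP; split=> // A Ab; apply: le_trans (Xg _ Ab); rewrite !gE; lra.
Qed.

Lemma small_multiplier (T : eqType) (s : seq T) (a b : T -> R) :
  (forall x, x \in s -> 0 < b x) ->
  exists2 e : R, 0 < e & forall x, x \in s -> e * a x < b x.
Proof.
elim: s => [_|x s IH h]; first by exists 1.
have [e e0 eh] := IH (fun y ys => h y (mem_behead (s := x :: s) ys)).
have bx : 0 < b x by apply: h; rewrite inE eqxx.
have d0 : 0 < `|a x| + 1 by rewrite ltr_wpDl.
pose e' := Num.min e (b x / (`|a x| + 1)).
have e'0 : 0 < e' by rewrite lt_min e0 divr_gt0.
have e'x : e' * (`|a x| + 1) <= b x by rewrite -ler_pdivlMr // ge_min lexx orbT.
exists e' => // y; rewrite inE => /orP[/eqP->|ys].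
  have := ler_norm (a x); have := ler_wpM2l (ltW e'0) (ler_norm (a x)).
  by move: e'x; rewrite mulrDr mulr1; lra.
have [ay|ay] := leP (a y) 0.
  have := h y; rewrite inE ys orbT => /(_ isT).
  by have := mulr_ge0_le0 (ltW e'0) ay; lra.
apply: le_lt_trans (eh y ys); rewrite ler_pM2r //.
by rewrite ge_min lexx.
Qed.

(** Lexicographic minimization: [e] is too small for [q] to bridge the gap between a non-minimizer
    of [g] and the minimum, so [q] only breaks ties. *)
Lemma mins_perturb g q : exists2 e : R, 0 < e &
  mins bs (fun A => g A + e * q A) = mins (mins bs g) q.
Proof.
have [noX|[X Xm]] := set_0Vmem (mins bs g).
  have [noB|[B Bb]] := set_0Vmem bs.
    by exists 1 => //; apply/setP => A; rewrite noB !inE.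
  case: (@arg_minP _ _ _ B [in bs] g Bb) => A Ab Amin.
  have : A \in mins bs g by apply/minsP.
  by rewrite noX inE.
have [Xb Xmin] := minsP _ _ _ Xm.
pose T := [seq (A, B) | A <- enum (bs :\: mins bs g), B <- enum bs].
have T0 AB : AB \in T -> 0 < g AB.1 - g X.
  move=> /allpairsP[[A B] /= [+ _ ->]].
  rewrite mem_enum inE => /andP[An Ab]; rewrite subr_gt0 ltNge.
  apply: contra An => le; apply/minsP; split=> // C Cb.
  by apply: le_trans le _; exact: Xmin.
have [e e0 eh] := small_multiplier (fun AB => q AB.2 - q AB.1) T0.
have far A B : A \in bs -> A \notin mins bs g -> B \in mins bs g ->
    g B + e * q B < g A + e * q A.
  move=> Ab An Bm; have [Bb _] := minsP _ _ _ Bm.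
  have ABT : (A, B) \in T by apply: allpairs_f; rewrite mem_enum // inE An.
  by have := eh _ ABT; rewrite /= (mins_eq Xm Bm); lra.
exists e => //; apply/setP => A; apply/minsP/minsP => -[].
  move=> Ab Amin.
  have Am : A \in mins bs g.
    by apply: contraT => An; have := far _ _ Ab An Xm; have := Amin _ Xb; lra.
  split=> // B Bm; have [Bb _] := minsP _ _ _ Bm.
  by have := Amin _ Bb; rewrite (mins_eq Am Bm) lerD2l ler_pM2l.
move=> Am Amin; have [Ab _] := minsP _ _ _ Am; split=> // B Bb.
have [Bm|Bn] := boolP (B \in mins bs g); last exact: ltW (far _ _ Bb Bn Am).
by rewrite (mins_eq Am Bm) lerD2l ler_pM2l // Amin.
Qed.

(* [C] is cut out of [D] by the difference of the two linear forms defining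
   them, since [f] is affine on [D]. *)
Lemma cell_face f g C D : cell bs f C -> cell bs f D -> C \subset D -> C != finset.set0 ->
  cell bs g D -> cell bs g C.
Proof.
move=> [u1 Ce] [u2 De] CD /set0Pn[X XC] [u3 De3].
pose q A := lin (fun i => u1 i + -1 * u2 i) A.
have [e e0 E] := mins_perturb (fun A => g A + lin u3 A) q.
exists (fun i => u3 i + e * (u1 i + -1 * u2 i)).
transitivity (mins bs (fun A => g A + lin u3 A + e * q A)); last first.
  by apply: eq_mins => A _; rewrite linD linZ addrA.
rewrite E -De3; apply/setP => A.
have fq A' : A' \in D -> q A' = f A' + lin u1 A' - (f X + lin u2 X).
  rewrite {1}De => A'D; rewrite /q linD linZ.
  have := subsetP CD _ XC; rewrite {1}De => XD.
  by have := mins_eq XD A'D; rewrite /=; lra.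
apply/idP/minsP => [AC|[AD Amin]].
  have AD := subsetP CD _ AC; split=> // B BD.
  rewrite !fq // lerD2r; move: AC; rewrite Ce => /minsP[_]; apply.
  by move: BD; rewrite De => /minsP[].
have XD := subsetP CD _ XC.
rewrite Ce; apply/minsP; split; first by move: AD; rewrite De => /minsP[].
move=> B Bb; have := Amin _ XD; rewrite !fq // lerD2r => /le_trans; apply.
by move: XC; rewrite Ce => /minsP[_]; apply.
Qed.

End Cells.

(** * Compatible functions have the same cells *)

Section SameCells.
Variables (R : realType) (n d : nat) (M : matroid n d).
Implicit Types (v w f : {set 'I_n} -> R) (X Y : {set 'I_n}) (C D : {set {set 'I_n}}).

Lemma cell_neq0 f C : cell (bases M) f C -> C != finset.set0.
Proof.
move=> [u ->]; have [B Bb] := bases_neq0 M; apply/set0Pn.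
case: (@arg_minP _ _ _ B [in bases M] (fun A => f A + lin u A) Bb) => A Ab Amin.
by exists A; apply/minsP.
Qed.

Lemma ex_max_cell f C : cell (bases M) f C -> exists D,
  [/\ cell (bases M) f D, C \subset D
    & forall D', cell (bases M) f D' -> D \subset D' -> D' = D].
Proof.
move=> fC; pose P D := `[< cell (bases M) f D >] && (C \subset D).
have PC : P C by rewrite /P subxx andbT; apply/asboolP.
case: (@arg_maxnP _ C P (fun D => #|D|) PC) => D /andP[/asboolP fD CD] Dmax.
exists D; split=> // D' fD' DD'; apply/esym/eqP; rewrite eqEcard DD' /=.
by apply: Dmax; rewrite /P (subset_trans CD DD') andbT; apply/asboolP.
Qed.

Lemma neutral_component v w X i x y : neutral_swap M v w X x y ->
  connect (neutral M v w X) i x = connect (neutral M v w X) i y.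
Proof.
move=> z; apply: (same_connect1r (sym_connect_sym (neutral_sym M v w X))).
by rewrite /neutral /= z.
Qed.

(* Take the potential with the most neutral exchanges at [X]: if an exchange inside
   the minimizers of [v] were not neutral, shifting the potential on a component of
   the neutral graph would make it neutral as well. *)
Lemma ex_neutral_potential v w X : compatible (bases M) v w ->
  X \in mins (bases M) v -> exists u : 'I_n -> R,
  forall i j, i \in X -> j \notin X -> swap X i j \in mins (bases M) v ->
    neutral_swap M v (fun A => w A + lin u A) X i j.
Proof.
move=> c Xm; pose Z (u : 'I_n -> R) := [set ij : 'I_n * 'I_n |
  neutral_swap M v (fun A => w A + lin u A) X ij.1 ij.2].
pose P z := `[< exists u, z = Z u >].
have P0 : P (Z (fun=> 0)) by apply/asboolP; exists (fun=> 0).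
case: (@arg_maxnP _ _ P (fun z => #|z|) P0) => z /asboolP[u ->] zmax.
exists u => i j iX jX Em; apply: contraT => nij.
have [Eb Emin] := minsP _ _ _ Em.
have vE := mins_eq Em Xm.
set w' := (fun A => w A + lin u A) in nij.
have c' : compatible (bases M) v w'.
  exact: compatible_linr.
pose K := connect (neutral M v w' X) i.
(* A neutral path from [i] to [j] would give the exchange the same sign for [v] and [w']; as it
   leaves [v] unchanged, it would be neutral. *)
have jK : ~~ K j.
  apply/negP => /connectP[p pth lst].
  have := neutral_path_same_sign c' Xm iX jX pth (esym lst) Eb.
  case=> -[]; last by rewrite vE ltxx.
  by move=> _ wE; move/negP: nij; apply; apply/neutral_swapP.
pose a := w' (swap X i j) - w' X.
pose u' x := u x + (if K x then a else 0).
have w'E A : w A + lin u' A = w' A + lin (fun x => if K x then a else 0) A.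
  by rewrite /u' linD addrA.
have /zmax : P (Z u') by apply/asboolP; exists u'.
suff : Z u \proper Z u' by move/proper_card => lt /(leq_trans lt); rewrite ltnn.
apply/properP; split.
  apply/subsetP => -[x y]; rewrite !inE /= => zxy.
  have [xX yX xyb vxy wxy] := neutral_swapP _ _ _ _ _ _ zxy.
  apply/neutral_swapP; split=> //; rewrite !w'E lin_swap //.
  have -> : K x = K y by exact: neutral_component zxy.
  by rewrite subrK; congr (_ + _); exact: wxy.
exists (i, j); rewrite !inE //=; apply/neutral_swapP; split=> //.
rewrite !w'E lin_swap // (negbTE jK) /K connect0 /a; lra.
Qed.

Lemma cell_sub_cell v w C : compatible (bases M) v w -> cell (bases M) v C ->
  exists2 D, cell (bases M) w D & C \subset D.
Proof.
move=> c vC; have [D [vD CD Dmax]] := ex_max_cell vC.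
have /set0Pn[X XD] := cell_neq0 vD.
have {vD} [u0 De] := vD.
set v' := (fun A => v A + lin u0 A) in De.
have c0 : compatible (bases M) v' w.
  by apply/compatible_sym/compatible_linr/compatible_sym.
have Xm : X \in mins (bases M) v' by rewrite -De.
have [Xb Xmin] := minsP _ _ _ Xm.
have [u uP] := ex_neutral_potential c0 Xm.
set w' := (fun A => w A + lin u A) in uP.
have c' : compatible (bases M) v' w'.
  exact: compatible_linr.
have wD : {in mins (bases M) v', forall Y, w' Y = w' X}.
  by apply: const_on_mins c' Xm _ => i j iX jX /(uP _ _ iX jX) /neutral_swapP[].
suff Xw : X \in mins (bases M) w'.
  exists (mins (bases M) w'); first by exists u.
  apply: subset_trans CD _; rewrite De; apply/subsetP => Y Ym.
  have [Yb _] := minsP _ _ _ Ym; have [_ Xw'] := minsP _ _ _ Xw.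
  by apply/minsP; split=> // A Ab; rewrite wD // Xw'.
apply: local_min_global => //; first exact: compatible_refl (compatible_sym c').
move=> i j iX jX Eb; pose K := connect (neutral M v' w' X) i.
have [/connectP[p pth lst]|jK] := boolP (K j).
  have := neutral_path_same_sign c' Xm iX jX pth (esym lst) Eb.
  by case=> -[_]; [move=> -> | move/ltW].
(* The indicator of the component of [i] drops under the exchange. It is constant on [D], by
   [const_on_mins] for [w'] and for [w'] plus this form, so [mins_grow] enlarges [D] against its
   maximality. *)
pose p x : R := if K x then 1 else 0.
have pE : lin p (swap X i j) < lin p X.
  by rewrite lin_swap // /p (negbTE jK) /K connect0; lra.
have pD : {in mins (bases M) v', forall Y, lin p Y = lin p X}.
  move=> Y Ym; have c'' : compatible (bases M) v' (fun A => w' A + lin p A).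
    exact: compatible_linr.
  apply: (@addrI _ (w' X)); rewrite -{1}(wD _ Ym).
  apply: (const_on_mins c'' Xm _ Ym) => x y xX yX /(uP _ _ xX yX) zxy.
  have [_ _ _ _ ->] := neutral_swapP _ _ _ _ _ _ zxy.
  by rewrite lin_swap // /p /K (neutral_component _ zxy) subrK.
have [s] := mins_grow Xm pD Eb pE; rewrite -De => DD'.
have := Dmax _ _ (proper_sub DD').
rewrite -(cell_lin _ _ u0).
case/properP: DD' => _ [Y YD' YD].
by move=> e; rewrite e ?(negbTE YD) // in YD'; exists (fun i => s * p i).
Qed.

Lemma compatible_cells v w C : compatible (bases M) v w ->
  cell (bases M) v C -> cell (bases M) w C.
Proof.
move=> c vC; have [D [vD CD Dmax]] := ex_max_cell vC.
have [D1 wD1 DD1] := cell_sub_cell c vD.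
have [D2 vD2 D12] := cell_sub_cell (compatible_sym c) wD1.
have D2D : D2 = D by apply: Dmax => //; apply: subset_trans D12.
have D1D : D1 = D by apply/eqP; rewrite eqEsubset DD1 -{1}D2D D12.
by apply: cell_face vC vD CD (cell_neq0 vC) _; rewrite -D1D.
Qed.

End SameCells.

(** The value 0 off the bases is a placeholder: [mins] and [tie] compare values at bases only. *)
Definition height (R : realType) (n d : nat) (M : matroid n d) (w : weight R M)
    (A : {set 'I_n}) : R :=
  if insub A is Some B then w B else 0.

(** * From minimizing terms to compatibility *)

Section PluckerTerms.
Variables (R : realType) (n d : nat) (M : matroid n d).
Implicit Types (v w : weight R M) (S : {set 'I_n}) (P Q T : {set 'I_n} * {set 'I_n}).

Lemma height_val w (B : basis M) : height w (val B) = w B.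
Proof. by rewrite /height valK. Qed.

Lemma ext_weightE w A :
  ext_weight w A = if A \in bases M then (height w A)%:E else +oo%E.
Proof. by rewrite /ext_weight /height; case: insubP => [B -> _|/negbTE->]. Qed.

Definition ext2 w P : \bar R := (ext_weight w P.1 + ext_weight w P.2)%E.

Lemma ext2E w P :
  ext2 w P = if both (bases M) P then (val2 (height w) P)%:E else +oo%E.
Proof.
rewrite /ext2 /both /val2 !ext_weightE.
by case: ifP => _ //=; case: ifP.
Qed.

Lemma plucker_termsE w S i j k l : plucker_terms w S i j k l =
  [tuple ext2 w (S :|: [set i; j], S :|: [set k; l]);
    ext2 w (S :|: [set i; k], S :|: [set j; l]);
    ext2 w (S :|: [set i; l], S :|: [set j; k])].
Proof. by []. Qed.

Lemma in_argmin3 (x y z : \bar R) (a : 'I_3) :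
  (a \in argmin [tuple x; y; z]) =
  let m := nth x [:: x; y; z] a in [&& m <= x, m <= y & m <= z]%E.
Proof.
rewrite inE /= (tnth_nth x) /=; apply/forallP/and3P => [h|[hx hy hz] b].
  split; [have := h (@Ordinal 3 0 isT)|have := h (@Ordinal 3 1 isT)
    |have := h (@Ordinal 3 2 isT)]; by rewrite (tnth_nth x).
by rewrite (tnth_nth x); case: b => [[|[|[|//]]] ?] /=.
Qed.

(** The last hypothesis says that the third term joins the minimum for both weights or for neither.
    The first alternative covers the minimum [+oo]. *)
Lemma tie_of_minima v w P Q T :
  (ext2 v P <= ext2 v Q)%E -> (ext2 v Q <= ext2 v P)%E ->
  (ext2 w P <= ext2 w Q)%E -> (ext2 w Q <= ext2 w P)%E ->
  (ext2 v P <= ext2 v T)%E -> (ext2 w P <= ext2 w T)%E ->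
  (ext2 v T <= ext2 v P)%E = (ext2 w T <= ext2 w P)%E ->
  [/\ ~~ both (bases M) P, ~~ both (bases M) Q & ~~ both (bases M) T] \/
  tie (bases M) (height v) (height w) P Q T.
Proof.
rewrite !ext2E; case bP: (both _ P); last first.
  by case bQ: (both _ Q) => //; case bT: (both _ T) => //; left.
case bQ: (both _ Q) => //; rewrite !lee_fin => PQ QP PQ' QP'.
have e : val2 (height v) P = val2 (height v) Q by apply/eqP; rewrite eq_le PQ.
have e' : val2 (height w) P = val2 (height w) Q by apply/eqP; rewrite eq_le PQ'.
case bT: (both _ T); last by move=> _ _ _; right; split; rewrite // bT.
rewrite !lee_fin => PT PT' TP; right; split=> // _.
have := PT; rewrite le_eqVlt => /orP[/eqP e1|l1].
  left; split=> //; apply/eqP.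
  by move: TP; rewrite -e1 lexx => /esym TP'; rewrite eq_le TP' PT'.
by move: TP; rewrite leNgt l1 => /esym/negbT; rewrite -ltNge => l2; right.
Qed.

Lemma card_pairU S i j : i \notin S -> j \notin S -> i != j ->
  #|S :|: [set i; j]| = (#|S| + 2)%N.
Proof.
move=> iS jS ij; rewrite finset.setUC -finset.setUA !cardsU1 jS addnA addnC.
by rewrite !inE negb_or ij iS.
Qed.

Lemma same_argmins_compatible v w : is_valuation v -> same_argmins v w ->
  compatible (bases M) (height v) (height w).
Proof.
move=> vv vw S i j k l u al.
move: (u) (al); rewrite /= !inE !negb_or -!andbA andbT.
move=> /and5P[ij ik il jk /andP[jl kl]] /and5P[iS jS kS lS _].
(* [compatible] allows [S] of any size; for a wrong size no set in the relation is a basis and all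
   terms are infinite. *)
have [dS|dS] := eqVneq (#|S| + 2)%N d; last first.
  have nb a b A : a \notin S -> b \notin S -> a != b ->
      ~~ both (bases M) (S :|: [set a; b], A).
    move=> aS bS ab; rewrite /both negb_and; apply/orP; left.
    by apply: contra dS => /card_basis <-; rewrite card_pairU.
  by apply: Or41; rewrite !nb.
have idx : plucker_index d S i j k l by rewrite /plucker_index dS eqxx u.
have := vw _ _ _ _ _ idx; have := vv _ _ _ _ _ idx.
rewrite /plucker_min !plucker_termsE.
set P := (_, S :|: [set k; l]); set Q := (_, S :|: [set j; l]).
set T := (_, S :|: [set j; k]).
move=> /card_gt1P[a [b [av bv ab]]] e.
have E c : (c \in argmin [tuple ext2 v P; ext2 v Q; ext2 v T]) =
    (c \in argmin [tuple ext2 w P; ext2 w Q; ext2 w T]) by rewrite e.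
have [aw bw] := (av, bv); rewrite !E in aw bw.
have := E (@Ordinal 3 0 isT); have := E (@Ordinal 3 1 isT).
have := E (@Ordinal 3 2 isT); move: av bv aw bw ab {e E}.
rewrite !in_argmin3 /=.
have third A B C : (ext2 v A <= ext2 v B)%E -> (ext2 v B <= ext2 v A)%E ->
    (ext2 w A <= ext2 w B)%E -> (ext2 w B <= ext2 w A)%E ->
    (ext2 v A <= ext2 v C)%E -> (ext2 w A <= ext2 w C)%E ->
    ((ext2 v C <= ext2 v A) && (ext2 v C <= ext2 v B))%E =
      ((ext2 w C <= ext2 w A) && (ext2 w C <= ext2 w B))%E ->
    [/\ ~~ both (bases M) A, ~~ both (bases M) B & ~~ both (bases M) C] \/
    tie (bases M) (height v) (height w) A B C.
  move=> v1 v2 w1 w2 v3 w3 e; apply: tie_of_minima => //.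
  transitivity ((ext2 v C <= ext2 v A) && (ext2 v C <= ext2 v B))%E.
    by apply/idP/andP => [CA|[]//]; split=> //; apply: le_trans v1.
  by rewrite e; apply/andP/idP => [[]//|CA]; split=> //; apply: le_trans w1.
rewrite !lexx !andbT /=.
case: a => [[|[|[|//]]] ?]; case: b => [[|[|[|//]]] ?] //=;
  move=> /and3P[v1 v2 v3] /and3P[v4 v5 v6] /and3P[w1 w2 w3] /and3P[w4 w5 w6] _ eT eQ eP.
- by case: (third P Q T) => // t; [apply: Or41 | apply: Or42].
- by case: (third P T Q) => // [[? ? ?]|t]; [apply: Or41 | apply: Or43].
- by case: (third P Q T) => // t; [apply: Or41 | apply: Or42].
- by case: (third Q T P) => // [[? ? ?]|t]; [apply: Or41 | apply: Or44].
- by case: (third P T Q) => // [[? ? ?]|t]; [apply: Or41 | apply: Or43].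
- by case: (third Q T P) => // [[? ? ?]|t]; [apply: Or41 | apply: Or44].
Qed.

End PluckerTerms.

(** * Minimal terms and common cells *)

Section CellsDetectTerms.
Variables (R : realType) (n d : nat) (M : matroid n d).
Implicit Types (f : {set 'I_n} -> R) (S E A B : {set 'I_n}).

Lemma mins_scale (bs : {set {set 'I_n}}) (c : R) f : 0 < c ->
  mins bs (fun A => c * f A) = mins bs f.
Proof.
move=> c0; apply/setP => B; apply/minsP/minsP => -[Bb h]; split=> // A Ab.
  by rewrite -(ler_pM2l c0) h.
by rewrite ler_pM2l // h.
Qed.

(** Each element contributes a nonnegative amount to [lin r A - lin r S], zero only if it respects
    the interval from [S] to [S :|: E]. This form isolates the bases in such an interval. *)
Lemma lin_interval_min S E A : let r x : R := if x \in S then -1 else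
    if x \in E then 0 else 1 in
  lin r S <= lin r A /\ (lin r A <= lin r S -> S \subset A /\ A \subset S :|: E).
Proof.
move=> r; pose t x := (if x \in A then r x else 0) - (if x \in S then r x else 0).
have t0 x : 0 <= t x.
  by rewrite /t /r; case: (x \in A); case: (x \in S); case: (x \in E); lra.
have tE : \sum_x t x = lin r A - lin r S.
  by rewrite sumrB /lin -!big_mkcond.
split; first by rewrite -subr_ge0 -tE sumr_ge0.
move=> le; have t00 x : t x = 0.
  have : \sum_x t x = 0 by apply/eqP; rewrite eq_le sumr_ge0 // andbT tE subr_le0.
  by move/psumr_eq0P; apply.
split; apply/subsetP => x xS; have := t00 x; rewrite /t xS.
  by case: (x \in A) => //; rewrite /r xS; lra.
rewrite inE /r; case: (x \in S) => //; case: (x \in E) => //=; lra.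
Qed.

(** A form [u] brings the four tied bases to a common level and the remaining two, when present, no
    lower. A dominant tilt by [r] confines the minimization to bases between [S] and [S :|: E]. *)
Lemma cell_of_minimal_term f S i j k l : (#|S| + 2)%N = d ->
  uniq [:: i; j; k; l] -> all [predC S] [:: i; j; k; l] ->
  both (bases M) (S :|: [set i; j], S :|: [set k; l]) ->
  both (bases M) (S :|: [set i; k], S :|: [set j; l]) ->
  val2 f (S :|: [set i; j], S :|: [set k; l]) =
    val2 f (S :|: [set i; k], S :|: [set j; l]) ->
  (both (bases M) (S :|: [set i; l], S :|: [set j; k]) ->
    val2 f (S :|: [set i; j], S :|: [set k; l]) <=
      val2 f (S :|: [set i; l], S :|: [set j; k])) ->
  exists C, [/\ cell (bases M) f C, S :|: [set i; j] \in C & S :|: [set k; l] \in C].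
Proof.
rewrite /both /val2 /=; move=> dS.
rewrite !inE !negb_or !andbT -!andbA.
move=> /and5P[ij ik il jk /andP[jl kl]] /and4P[iS jS kS lS].
pose F a b := S :|: [set a; b].
have FC a b : F a b = F b a by rewrite /F [[set a; b]]finset.setUC.
rewrite -/(F i j) -/(F k l) -/(F i k) -/(F j l) -/(F i l) -/(F j k).
move=> /andP[bij bkl] /andP[bik bjl] e le.
(* The four tie equations leave [u i] free. This choice levels [F i l] if it is a basis, and [F j k]
   otherwise; if both are bases, [le] keeps [F j k] nonnegative. *)
pose x := if F i l \in bases M then (f (F k l) - f (F i k) - f (F i l)) / 2
          else (f (F j k) - f (F i j) - f (F i k)) / 2.
pose u y : R := if y == i then x else if y == j then - f (F i j) - x else
  if y == k then - f (F i k) - x else if y == l then - f (F k l) + f (F i k) + x else 0.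
have ui : u i = x by rewrite /u eqxx.
have uj : u j = - f (F i j) - x by rewrite /u eq_sym (negbTE ij) eqxx.
have uk : u k = - f (F i k) - x.
  by rewrite /u (eq_sym k) (negbTE ik) (eq_sym k) (negbTE jk) eqxx.
have ul : u l = - f (F k l) + f (F i k) + x.
  by rewrite /u !(eq_sym l) (negbTE il) (negbTE jl) (negbTE kl) eqxx.
have pij : f (F i j) + (u i + u j) = 0 by rewrite ui uj; lra.
have pik : f (F i k) + (u i + u k) = 0 by rewrite ui uk; lra.
have pkl : f (F k l) + (u k + u l) = 0 by rewrite uk ul; lra.
have pjl : f (F j l) + (u j + u l) = 0 by rewrite uj ul; lra.
have pos a b : a \in [:: i; j; k; l] -> b \in [:: i; j; k; l] -> a != b ->
    F a b \in bases M -> 0 <= f (F a b) + (u a + u b).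
  have pil : F i l \in bases M -> 0 <= f (F i l) + (u i + u l).
    by move=> h; rewrite ui ul /x h; lra.
  have pjk : F j k \in bases M -> 0 <= f (F j k) + (u j + u k).
    move=> h; rewrite uj uk /x; case: ifP => h'; last by lra.
    by move: le; rewrite h h' => /(_ isT); lra.
  rewrite !inE => /or4P[] /eqP-> /or4P[] /eqP->; rewrite ?eqxx // => _.
  - by rewrite pij.
  - by rewrite pik.
  - by rewrite FC [u j + _]addrC pij.
  - by rewrite pjl.
  - by rewrite FC [u k + _]addrC pik.
  - by rewrite FC [u k + _]addrC; exact: pjk.
  - by rewrite pkl.
  - by rewrite FC [u l + _]addrC; exact: pil.
  - by rewrite FC [u l + _]addrC pjl.
  - by rewrite FC [u l + _]addrC pkl.
pose E := [set y | y \in [:: i; j; k; l]].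
have inE0 y : (y \in E) = (y \in [:: i; j; k; l]) by rewrite inE.
pose r y : R := if y \in S then -1 else if y \in E then 0 else 1.
pose q A := f A + lin u A.
have [c c0 cE] := mins_perturb (bases M) (lin r) q.
have rF a b : a \in [:: i; j; k; l] -> b \in [:: i; j; k; l] -> a \notin S ->
    b \notin S -> a != b -> lin r (F a b) = lin r S.
  by move=> ha hb aS bS ab; rewrite lin_pair // /r (negbTE aS) (negbTE bS) !inE0 ha hb; lra.
have qF a b : a \notin S -> b \notin S -> a != b ->
    q (F a b) = lin u S + (f (F a b) + (u a + u b)).
  by move=> aS bS ab; rewrite /q lin_pair //; lra.
have Fmin a b : a \in [:: i; j; k; l] -> b \in [:: i; j; k; l] -> a \notin S ->
    b \notin S -> a != b -> F a b \in bases M -> f (F a b) + (u a + u b) = 0 ->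
    F a b \in mins (mins (bases M) (lin r)) q.
  move=> ha hb aS bS ab Fb F0; apply/minsP; split.
    apply/minsP; split=> // A Ab; rewrite rF //.
    by have [] := lin_interval_min S E A.
  move=> A /minsP[Ab Amin].
  have [_ inter] := lin_interval_min S E A.
  have [SA ASE] : S \subset A /\ A \subset S :|: E.
    by apply: inter; have := Amin _ Fb; rewrite rF.
  have /cards2P[a' [b' [ab' E']]] : #|A :\: S| == 2%N.
    by rewrite cardsD (finset.setIidPr SA) (card_basis Ab) -dS addKn.
  have AE : A = F a' b' by rewrite /F -E' -{1}(finset.setID A S) (finset.setIidPr SA).
  have inA z : z \in [set a'; b'] -> z \in [:: i; j; k; l] /\ z \notin S.
    rewrite -E' finset.in_setD => /andP[zS zA]; split=> //.
    by have := subsetP ASE _ zA; rewrite inE (negbTE zS) /= inE0.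
  have [ha' a'S] : a' \in [:: i; j; k; l] /\ a' \notin S by apply: inA; rewrite !inE eqxx.
  have [hb' b'S] : b' \in [:: i; j; k; l] /\ b' \notin S.
    by apply: inA; rewrite !inE eqxx orbT.
  by rewrite AE !qF // F0 lerD2l pos // -AE.
exists (mins (mins (bases M) (lin r)) q); split.
(* Dividing [lin r + c * q] by [c] puts it into the form [f] plus a linear form. *)
- exists (fun y => u y + c^-1 * r y); rewrite -cE.
  rewrite -[RHS](mins_scale _ _ c0).
  apply: eq_mins => A _; rewrite linD linZ /q !mulrDr mulVKf ?gt_eqF //; lra.
- by apply: Fmin; rewrite ?inE ?eqxx ?orbT //.
- by apply: Fmin; rewrite ?inE ?eqxx ?orbT //.
Qed.

(** Adding the two minimality inequalities cancels the linear form, since both terms cover the same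
    elements with the same multiplicities. *)
Lemma minimal_term_of_cell f C S i j k l :
  uniq [:: i; j; k; l] -> all [predC S] [:: i; j; k; l] ->
  cell (bases M) f C -> S :|: [set i; j] \in C -> S :|: [set k; l] \in C ->
  both (bases M) (S :|: [set i; k], S :|: [set j; l]) ->
  val2 f (S :|: [set i; j], S :|: [set k; l]) <=
    val2 f (S :|: [set i; k], S :|: [set j; l]).
Proof.
rewrite /both /val2 /= !inE !negb_or !andbT -!andbA.
move=> /and5P[ij ik il jk /andP[jl kl]] /and4P[iS jS kS lS] [u ->].
move=> /minsP[_ m1] /minsP[_ m2] /andP[bik bjl].
have := m1 _ bik; have := m2 _ bjl; rewrite !lin_pair //; lra.
Qed.

End CellsDetectTerms.

(** * Equal cells give equal minimizing terms *)

Section SameArgmins.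
Variables (R : realType) (n d : nat) (M : matroid n d).
Implicit Types (v w : weight R M) (S : {set 'I_n}).

(** A finite minimal term of [v] puts its two bases into a common cell, which is a cell of [w] and
    makes the term minimal there. An infinite minimum depends on the bases alone. *)
Lemma minimal_term_transfer v w S i j k l : is_valuation v ->
  (forall C, cell (bases M) (height v) C -> cell (bases M) (height w) C) ->
  (#|S| + 2)%N = d -> uniq [:: i; j; k; l] -> all [predC S] [:: i; j; k; l] ->
  (ext2 v (S :|: [set i; j], S :|: [set k; l]) <=
    ext2 v (S :|: [set i; k], S :|: [set j; l]))%E ->
  (ext2 v (S :|: [set i; j], S :|: [set k; l]) <=
    ext2 v (S :|: [set i; l], S :|: [set j; k]))%E ->
  (ext2 w (S :|: [set i; j], S :|: [set k; l]) <=
    ext2 w (S :|: [set i; k], S :|: [set j; l]))%E /\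
  (ext2 w (S :|: [set i; j], S :|: [set k; l]) <=
    ext2 w (S :|: [set i; l], S :|: [set j; k]))%E.
Proof.
move=> vv vw dS u al.
have u' : uniq [:: i; j; l; k].
  move: u; rewrite /= !inE !negb_or !andbT -!andbA => /and5P[-> -> -> -> /andP[-> ?]].
  by rewrite eq_sym.
have al' : all [predC S] [:: i; j; l; k].
  by move: al; rewrite /= => /and5P[-> -> -> -> _].
have klC : [set l; k] = [set k; l] by rewrite finset.setUC.
have ties : same_ties (bases M) (height v) (height v)
  (S :|: [set i; j], S :|: [set k; l]) (S :|: [set i; k], S :|: [set j; l])
  (S :|: [set i; l], S :|: [set j; k]) by exact: same_argmins_compatible.
rewrite !ext2E; case bP: (both _ (_, S :|: [set k; l])); last first.
  by case: (both _ (_, S :|: [set j; l])) => //; case: (both _ (_, S :|: [set j; k])).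
move=> PQ PT.
have [C [vC C1 C2]] : exists C, [/\ cell (bases M) (height v) C,
    S :|: [set i; j] \in C & S :|: [set k; l] \in C].
  (* The minimal first term ties with one of the others; a tie with the third is reduced to the
     second by exchanging [k] and [l]. *)
  case: ties => [[]|[_ bQ e _ _]|[_ bT e _ _]|[bQ bT e _ /(_ bP) h]].
  - by rewrite bP.
  - apply: cell_of_minimal_term => // bT.
    by move: PT; rewrite bT lee_fin.
  - have := @cell_of_minimal_term _ _ _ M (height v) S i j l k dS u' al'.
    rewrite klC; apply=> // bQ.
    by move: PQ; rewrite bQ lee_fin.
  - move: PQ PT; rewrite bQ bT !lee_fin => PQ PT.
    apply: cell_of_minimal_term => //.
    by apply/eqP; rewrite eq_le PQ; case: h => -[h _]; rewrite ?h ?lexx // ltW.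
have wC := vw _ vC; split.
  case: ifP => bQ; last by rewrite leey.
  by rewrite lee_fin; apply: minimal_term_of_cell wC _ _ _.
case: ifP => bT; last by rewrite leey.
rewrite lee_fin -klC; apply: minimal_term_of_cell wC _ _ _ => //.
by rewrite klC.
Qed.

Lemma sub_plucker_min v w S i j k l : is_valuation v ->
  (forall C, cell (bases M) (height v) C -> cell (bases M) (height w) C) ->
  plucker_index d S i j k l ->
  plucker_min v S i j k l \subset plucker_min w S i j k l.
Proof.
move=> vv vw /and3P[/eqP dS u al]; apply/subsetP => a.
rewrite /plucker_min !plucker_termsE !in_argmin3.
move: (u) (al); rewrite /= !inE !negb_or -!andbA andbT.
move=> /and5P[ij ik il jk /andP[jl kl]] /and5P[iS jS kS lS _].
have := @minimal_term_transfer v w S i j k l vv vw dS u al.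
have := @minimal_term_transfer v w S i k j l vv vw dS.
have := @minimal_term_transfer v w S i l j k vv vw dS.
rewrite /= !inE !negb_or ij ik il jk jl kl iS jS kS lS (eq_sym k j) jk.
rewrite !(eq_sym l) jl kl /= => /(_ isT isT) t3 /(_ isT isT) t2 t1.
rewrite [[set k; j]]finset.setUC in t2.
rewrite [[set l; j]]finset.setUC [[set l; k]]finset.setUC in t3.
case: a => [[|[|[|//]]] ?] /=; rewrite !lexx /=.
- by move=> /andP[/t1 h /h[-> ->]].
- by move=> /andP[/t2 h /h[-> ->]].
- by rewrite !andbT => /andP[/t3 h /h[-> ->]].
Qed.

Lemma same_cells_argmins v w : is_valuation v -> is_valuation w ->
  (forall C, cell (bases M) (height v) C <-> cell (bases M) (height w) C) ->
  same_argmins v w.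
Proof.
move=> vv wv vw S i j k l idx; apply/eqP.
by rewrite eqEsubset !sub_plucker_min // => C /vw.
Qed.

End SameArgmins.

(** * Cells as polytopes in the regular subdivision *)

Section Geometry.
Variables (R : realType) (n d : nat) (M : matroid n d).
Implicit Types (w : weight R M) (C D E F : {set {set 'I_n}}).

Lemma indicatorE (S : {set 'I_n}) i : indicator R S 0 i = (i \in S)%:R.
Proof.
rewrite /indicator summxE; have [iS|iS] := boolP (i \in S).
  rewrite (bigD1 i) //= mxE !eqxx big1 ?addr0 // => j /andP[_ ji].
  by rewrite mxE eqxx eq_sym (negbTE ji).
rewrite big1 // => j jS; rewrite mxE eqxx.
by case: eqVneq => // ij; rewrite ij jS in iS.
Qed.

Lemma linear_form_sum (I : finType) (u : 'rV[R]_n) (a : R) (l : I -> R)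
    (q : I -> 'rV[R]_n * R^o) :
  linear_form u a (\sum_i l i *: q i) = \sum_i l i * linear_form u a (q i).
Proof.
have D : {morph linear_form u a : x y / x + y}.
  move=> x y; rewrite /linear_form /= mulrDr addrACA -big_split /=.
  by congr (_ + _); apply: eq_bigr => i _; rewrite mxE mulrDr.
have z : linear_form u a 0 = 0.
  rewrite /linear_form /= mulr0 addr0 big1 // => i _.
  by rewrite mxE mulr0.
rewrite (big_morph _ D z); apply: eq_bigr => i _.
rewrite /linear_form /= mulrDr mulr_sumr; congr (_ + _); last first.
  by rewrite /GRing.scale /= mulrCA.
by apply: eq_bigr => x _; rewrite mxE mulrCA.
Qed.

Lemma linear_form_vertex w (u : 'rV[R]_n) (a : R) (B : basis M) :
  linear_form u a (indicator R (val B), w B) =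
  a * height w (val B) + lin (u 0) (val B).
Proof.
rewrite /linear_form /= height_val addrC; congr (_ + _).
rewrite /lin [RHS]big_mkcond /=; apply: eq_bigr => i _.
by rewrite indicatorE; case: (i \in _); rewrite ?mulr1 ?mulr0.
Qed.

Definition cell_hull C : set 'rV[R]_n :=
  [set x | exists l : basis M -> R,
    [/\ forall B, 0 <= l B, \sum_B l B = 1, forall B, l B != 0 -> val B \in C
      & x = \sum_B l B *: indicator R (val B)]]%classic.

(** On a convex combination the linear form is the average of [g]; it reaches the minimum of [g]
    exactly when the coefficients are supported on minimizers. *)
Lemma face_lift w (u : 'rV[R]_n) (a : R) :
  (fst @` face (conv_hull (fun B : basis M => (indicator R (val B), w B))) u a)%classic =
  cell_hull (mins (bases M) (fun A => a * height w A + lin (u 0) A)).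
Proof.
set g := fun A : {set 'I_n} => (_ + _ : R); set q := fun B : basis M => _.
have gE (l : basis M -> R) :
    linear_form u a (\sum_B l B *: q B) = \sum_B l B * g (val B).
  by rewrite linear_form_sum; apply: eq_bigr => B _; rewrite linear_form_vertex.
have [X [Xb Xmin]] : exists X, X \in bases M /\ forall A, A \in bases M -> g X <= g A.
  have [B Bb] := bases_neq0 M.
  by case: (@arg_minP _ _ _ B [in bases M] g Bb) => X ? ?; exists X.
have lower (l : basis M -> R) : (forall B, 0 <= l B) -> \sum_B l B = 1 ->
    g X <= \sum_B l B * g (val B).
  move=> l0 l1; rewrite -[g X]mul1r -l1 mulr_suml; apply: ler_sum => B _.
  by rewrite ler_wpM2l // Xmin // (valP B).
apply/seteqP; split=> [_ [_ [[l [l0 l1 ->]] qmin] <-]|x [l [l0 l1 lC ->]]].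
  exists l; split=> //; last by rewrite (raddf_sum (@fst _ _)).
  (* The point mass at a minimizer [X], against which the minimality of the face point is tested. *)
  pose l' (B : basis M) : R := (B == Sub X Xb)%:R.
  have l'E (f : basis M -> R) : \sum_B l' B * f B = f (Sub X Xb).
    rewrite (bigD1 (Sub X Xb)) //= /l' eqxx mul1r big1 ?addr0 // => B /negbTE->.
    by rewrite mul0r.
  have : linear_form u a (\sum_B l B *: q B) <= g X.
    apply: le_trans (qmin (\sum_B l' B *: q B) _) _.
      exists l'; split=> //.
      by have := l'E (fun=> 1); under eq_bigr do rewrite mulr1.
    by rewrite gE l'E SubK.
  rewrite gE => le.
  have s0 : \sum_B l B * (g (val B) - g X) = 0.
    under eq_bigr do rewrite mulrBr.
    rewrite sumrB -mulr_suml l1 mul1r; apply/eqP; rewrite subr_eq0 eq_le le.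
    exact: lower.
  move=> B lB; apply/minsP; split=> [|A Ab]; first exact: (valP B).
  suff -> : g (val B) = g X by exact: Xmin.
  have : l B * (g (val B) - g X) = 0.
    move/psumr_eq0P: s0; apply=> // B' _.
    by rewrite mulr_ge0 // subr_ge0 Xmin // (valP B').
  by move/eqP; rewrite mulf_eq0 (negbTE lB) /= subr_eq0 => /eqP.
exists (\sum_B l B *: q B); last by rewrite (raddf_sum (@fst _ _)).
split; first by exists l.
move=> _ [l' [l'0 l'1 ->]]; rewrite !gE.
apply: le_trans (lower _ l'0 l'1).
rewrite -[g X]mul1r -l1 mulr_suml; apply: ler_sum => B _.
have [->|lB] := eqVneq (l B) 0; first by rewrite !mul0r.
by rewrite ler_wpM2l //; have /minsP[_] := lC _ lB; apply.
Qed.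

(** Lower faces have [a > 0], so dividing by [a] normalizes the coefficient of the height to 1. *)
Lemma matroid_subdivisionE w :
  matroid_subdivision w = (cell_hull @` cell (bases M) (height w))%classic.
Proof.
apply/seteqP; split=> [_ [_ [u [a a0 ->]] <-]|_ [_ [u ->] <-]].
  rewrite face_lift; set C := mins _ _; exists C => //.
  exists (fun i => a^-1 * u 0 i); rewrite /C -[RHS](mins_scale _ _ a0).
  by apply: eq_mins => A _; rewrite linZ mulrDr mulVKf ?gt_eqF.
exists (face (conv_hull (fun B : basis M => (indicator R (val B), w B))) (\row_i u i) 1).
  by exists (\row_i u i), 1.
rewrite face_lift; congr cell_hull; apply: eq_mins => A _.
by rewrite mul1r; congr (_ + _); apply: eq_bigr => i _; rewrite mxE.
Qed.

(** Indicators are vertices of the unit cube: in each coordinate the value at [B] is extreme, so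
    every basis with nonzero coefficient agrees with [B] there. *)
Lemma cell_hull_vertex C (B : basis M) :
  cell_hull C (indicator R (val B)) <-> val B \in C.
Proof.
split=> [[l [l0 l1 lC e]]|BC]; last first.
  exists (fun A => (A == B)%:R); split=> [A|||]; first by rewrite ler0n.
  - by rewrite (bigD1 B) //= eqxx big1 ?addr0 // => A AB; rewrite (negbTE AB).
  - by move=> A; have [->|] := eqVneq A B; rewrite ?eqxx.
  - rewrite (bigD1 B) //= eqxx scale1r big1 ?addr0 // => A AB.
    by rewrite (negbTE AB) scale0r.
have : exists A, l A != 0.
  apply: contrapT => no; move/eqP: l1; rewrite big1 ?(eq_sym 0) ?oner_eq0 // => A _.
  by apply/eqP; apply: contrapT => /negP h; apply: no; exists A.
move=> [A lA]; suff <- : val A = val B by exact: lC.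
have coord i : \sum_A' l A' * ((i \in val A')%:R - (i \in val B)%:R) = 0.
  under eq_bigr do rewrite mulrBr.
  rewrite sumrB -mulr_suml l1 mul1r -(indicatorE (val B)) e summxE; apply/eqP.
  by rewrite subr_eq0; apply/eqP; apply: eq_bigr => A' _; rewrite mxE indicatorE.
apply/setP => i; have := coord i; have [iB|iB] := boolP (i \in val B).
  under eq_bigr do rewrite -[_ * _]opprK -mulrN opprB.
  rewrite sumrN => /eqP; rewrite oppr_eq0 => /eqP/psumr_eq0P h.
  have /h/(_ A isT)/eqP : forall A', true -> 0 <= l A' * (1 - (i \in val A')%:R).
    by move=> A' _; rewrite mulr_ge0 //; case: (i \in _) => /=; lra.
  by rewrite mulf_eq0 (negbTE lA) /=; case: (i \in val A); rewrite // subr0 oner_eq0.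
move=> /psumr_eq0P h.
have /h/(_ A isT)/eqP : forall A', true -> 0 <= l A' * ((i \in val A')%:R - 0%:R).
  by move=> A' _; rewrite mulr_ge0 //; case: (i \in _) => /=; lra.
by rewrite mulf_eq0 (negbTE lA) /=; case: (i \in val A); rewrite // subr0 oner_eq0.
Qed.

Lemma cell_hull_inj C D : C \subset bases M -> D \subset bases M ->
  cell_hull C = cell_hull D -> C = D.
Proof.
have sub E F : E \subset bases M -> cell_hull E = cell_hull F -> E \subset F.
  move=> Eb e; apply/subsetP => A AE; have Ab := subsetP Eb _ AE.
  have := (cell_hull_vertex F (Sub A Ab)).1; rewrite SubK; apply.
  by rewrite -e; have := (cell_hull_vertex E (Sub A Ab)).2; rewrite SubK; apply.
by move=> Cb Db e; apply/eqP; rewrite eqEsubset (sub _ _ Cb e) (sub _ _ Db (esym e)).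
Qed.

Lemma cell_sub_bases (f : {set 'I_n} -> R) C : cell (bases M) f C -> C \subset bases M.
Proof. by move=> [u ->]; apply/subsetP => A /minsP[]. Qed.

Lemma same_subdivisionP (v w : weight R M) :
  matroid_subdivision v = matroid_subdivision w <->
  (forall C, cell (bases M) (height v) C <-> cell (bases M) (height w) C).
Proof.
rewrite !matroid_subdivisionE; split=> [e C|e].
  have sub (x y : weight R M) :
      (cell_hull @` cell (bases M) (height x) =
       cell_hull @` cell (bases M) (height y))%classic ->
      cell (bases M) (height x) C -> cell (bases M) (height y) C.
    move=> exy xC.
    have : (cell_hull @` cell (bases M) (height x))%classic (cell_hull C) by exists C.
    rewrite exy => -[D yD eDC]; by rewrite -(cell_hull_inj (cell_sub_bases yD) (cell_sub_bases xC) eDC).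
  by split; [exact: sub e | exact: sub (esym e)].
by congr (_ @` _)%classic; apply/seteqP; split=> C /e.
Qed.

End Geometry.

Theorem mainTheorem3 (R : realType) (n d : nat) (M : matroid n d)
    (v w : tropical_torus R M) :
  local_dressian v -> local_dressian w ->
  (same_plucker_cone v w <-> same_secondary_cone v w).
Proof.
rewrite /local_dressian /same_plucker_cone /same_secondary_cone /= => vv wv.
rewrite same_subdivisionP; split=> [vw C|]; last exact: same_cells_argmins.
have c := same_argmins_compatible vv vw.
by split; apply: compatible_cells => //; exact: compatible_sym.
Qed.
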